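(* There is an absolute constant $C_1>0$, and for every $c\ge1$ a constant $C=C(c)>0$ depending only on $c$, such that the following holds. Let $A$ be a real $m\times n$ matrix of full column rank $n$ with flat-tailed spectrum, i.e. there is an index $1\le r\le n$ such that $\sigma_i^2(A)\le c\,\sigma_{\min}^2(A)$ for all $i\ge r$. Then for any $k\le n$ with $k\ge\max\{2r,C_1\}$, the iterates of sketch-and-project with $S$ a $k\times m$ Gaussian matrix satisfy, for every $x_0\in\mathbb{R}^n$ and all $t\ge0$, $$\mathbb{E}\,\|x_t-x_*\|^2\le\Big(1-\frac{k}{Cn}\Big)^t\|x_0-x_*\|^2.$$
   Context: A Gaussian matrix has i.i.d. $N(0,1)$ entries. $\sigma_1(A)\ge\sigma_2(A)\ge\dots$ are the singular values of $A$ and $\sigma_{\min}(A)=\sigma_n(A)$ is the smallest. $\|\cdot\|$ is the Euclidean norm and $(\cdot)^\dagger$ the Moore-Penrose pseudoinverse. Sketch-and-project: given a consistent linear system $Ax=b$ with $A\in\mathbb{R}^{m\times n}$, $m\ge n$, and unique solution $x_*$, the iterates are $x_{t+1}=x_t-(S_tA)^\dagger S_t(Ax_t-b)$, $t=0,1,2,\dots$, where $S_0,S_1,\dots$ are independent copies of the random $k\times m$ sketching matrix $S$. *)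

(* Defs.v *)
From HB Require Import structures.
From mathcomp Require Import all_boot all_order all_algebra.
From mathcomp Require Import finmap all_classical all_reals all_analysis.
From mathcomp Require Import complex.

Set Implicit Arguments.
Unset Strict Implicit.
Unset Printing Implicit Defensive.

Import Order.TTheory GRing.Theory Num.Theory.
Local Open Scope classical_set_scope.
Local Open Scope ring_scope.

Section EuclideanNorm.
Variable R : realType.

(* The library's norm `|v| on vectors is the sup norm, hence this one. *)
Definition norm2 n (v : 'cV[R]_n) : R := Num.sqrt (\sum_(i < n) v i 0 ^+ 2).

End EuclideanNorm.

Section SingularValues.
Variable R : realType.

(* The squares of the entries of s are the eigenvalues of A^T A, counted with
   multiplicity, so s has n entries when A has n columns. *)
Definition is_singular_values m n (A : 'M[R]_(m, n)) (s : seq R) : Prop :=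
  [/\ sorted >=%R s, all (>= 0) s &
      char_poly (A^T *m A) = \prod_(x <- s) ('X - (x ^+ 2)%:P)].

Definition singular_values m n (A : 'M[R]_(m, n)) : seq R :=
  xget [::] [set s | is_singular_values A s].

(* 1-based: sigma A 1 >= sigma A 2 >= ...; sigma A i = 0 for i > n, and the
   value at i = 0 is meaningless. *)
Definition sigma m n (A : 'M[R]_(m, n)) (i : nat) : R :=
  nth 0 (singular_values A) i.-1.

Definition sigma_min m n (A : 'M[R]_(m, n)) : R := sigma A n.

Lemma singular_values_exist m n (A : 'M[R]_(m, n)) :
  exists s, is_singular_values A s.
Proof.
pose f := real_complex R; pose B := map_mx f A.
have fG : map_mx f (A^T *m A) = B^T *m B by rewrite map_mxM map_trmx.
have [r Dr] := closed_field_poly_normal (char_poly (B^T *m B)).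
rewrite (monicP (char_poly_monic _)) scale1r in Dr.
have sumsq_ge0 p (u : 'rV[R[i]]_p) : 0 <= \sum_j u 0 j * (u 0 j)^*%R.
  by apply: sumr_ge0 => j _; rewrite mul_conjC_ge0.
have r_ge0 z : z \in r -> 0 <= z.
  move=> zr.
  have : eigenvalue (B^T *m B) z by rewrite eigenvalue_root_char Dr root_prod_XsubC.
  case/eigenvalueP => v vG v0.
  have vv : 0 < \sum_j v 0 j * (v 0 j)^*%R.
    rewrite lt_neqAle sumsq_ge0 andbT eq_sym; apply: contra v0.
    rewrite psumr_eq0 => [/allP v0|j _]; last by rewrite mul_conjC_ge0.
    apply/eqP/rowP => j; rewrite mxE; apply/eqP.
    by have := v0 j (mem_index_enum j); rewrite mul_conjC_eq0.
  have E p (u w : 'rV[R[i]]_p) :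
    (u *m (map_mx Num.conj w)^T) 0 0 = \sum_j u 0 j * (w 0 j)^*%R.
    by rewrite mxE; apply: eq_bigr => j _; rewrite !mxE.
  have cB : map_mx Num.conj B^T = B^T.
    apply/matrixP => i j; rewrite !mxE; apply/conj_Creal.
    by apply/CrealP; rewrite /f /=; apply/eqP; rewrite eq_complex /= oppr0 !eqxx.
  have : (v *m (B^T *m B) *m (map_mx Num.conj v)^T) 0 0
         = z * \sum_j v 0 j * (v 0 j)^*%R.
    by rewrite vG -scalemxAl mxE E.
  rewrite mulmxA -mulmxA.
  have -> : B *m (map_mx Num.conj v)^T
     = (map_mx Num.conj (v *m B^T))^T.
    by rewrite map_mxM [map_mx _ B^T]cB trmx_mul trmxK.
  by rewrite E => Ez; rewrite -(pmulr_lge0 _ vv) -Ez.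
pose q := [seq complex.Re z | z <- r].
have rE : r = [seq f x | x <- q].
  rewrite -map_comp -[LHS]map_id; apply/eq_in_map => z /r_ge0.
  by case: z => a b; rewrite lecE /= => /andP[/eqP -> _].
have q_ge0 : all (>= 0) q.
  apply/allP => x xq; have := r_ge0 (f x).
  by rewrite rE (mem_map (@complexI R)) => /(_ xq); rewrite lecR.
exists (sort >=%R [seq Num.sqrt x | x <- q]); split.
- by apply: sort_sorted => x y; rewrite orbC le_total.
- by rewrite all_sort all_map; apply/allP => x _; rewrite /= sqrtr_ge0.
rewrite (perm_big [seq Num.sqrt x | x <- q]) /=; last by rewrite perm_sort.
rewrite big_map; apply: (map_poly_inj f).
rewrite map_char_poly fG Dr rE big_map rmorph_prod big_seq [RHS]big_seq.
apply: eq_bigr => x xq.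
by rewrite rmorphB /= map_polyX map_polyC /= sqr_sqrtr// (allP q_ge0).
Qed.

Lemma is_singular_values_uniq m n (A : 'M[R]_(m, n)) s1 s2 :
  is_singular_values A s1 -> is_singular_values A s2 -> s1 = s2.
Proof.
move=> [so1 /allP p1 e1] [so2 /allP p2]; rewrite {}e1 => e.
have /prod_XsubC_eq pe : \prod_(x <- [seq x ^+ 2 | x <- s1]) ('X - x%:P)
    = \prod_(x <- [seq x ^+ 2 | x <- s2]) ('X - x%:P) by rewrite !big_map.
apply: (@sorted_eq _ >=%R) => //.
- by move=> x y z xy yz; exact: le_trans yz xy.
- by move=> x y; rewrite andbC => /le_anti.
have := perm_map Num.sqrt pe; rewrite -!map_comp.
have K s : {in s, forall x, 0 <= x} -> map (Num.sqrt \o (fun x : R => x ^+ 2)) s = s.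
  move=> ps; rewrite -[RHS]map_id; apply/eq_in_map => x /ps x0 /=.
  by rewrite sqrtr_sqr ger0_norm.
by rewrite !K.
Qed.

Lemma singular_valuesP m n (A : 'M[R]_(m, n)) :
  is_singular_values A (singular_values A).
Proof.
by have [s As] := singular_values_exist A; exact: (@xgetI _ _ _ s).
Qed.

End SingularValues.

Section PseudoInverse.
Variable R : realType.

Definition penrose m n (A : 'M[R]_(m, n)) (X : 'M[R]_(n, m)) : Prop :=
  [/\ A *m X *m A = A, X *m A *m X = X,
      (A *m X)^T = A *m X & (X *m A)^T = X *m A].

(* The library's pinvmx is only some generalized inverse. *)
Definition mpinv m n (A : 'M[R]_(m, n)) : 'M[R]_(n, m) :=
  xget 0 [set X | penrose A X].

Lemma gram_unit m n (D : 'M[R]_(m, n)) : row_free D -> D *m D^T \in unitmx.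
Proof.
move=> freeD; rewrite -row_free_unit -kermx_eq0.
apply/eqP/row_matrixP => i; rewrite row0; set v := row i _.
have vK : v *m (D *m D^T) = 0 by apply/sub_kermxP; exact: row_sub.
have ww0 : v *m D *m (v *m D)^T = 0.
  by rewrite trmx_mul mulmxA -(mulmxA v) vK mul0mx.
apply: (row_free_inj freeD); rewrite mul0mx.
move: (v *m D) ww0 => w /matrixP/(_ 0 0); rewrite mxE [RHS]mxE => /eqP.
rewrite psumr_eq0 => [/allP w0|j _]; last by rewrite mxE -expr2 sqr_ge0.
apply/rowP => j; have := w0 j (mem_index_enum j).
by rewrite !mxE -expr2 sqrf_eq0 => /eqP.
Qed.

Lemma penrose_exist m n (A : 'M[R]_(m, n)) : exists X, penrose A X.
Proof.
suff H r (C : 'M[R]_(m, r)) (D : 'M[R]_(r, n)) :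
    row_free C^T -> row_free D -> exists X, penrose (C *m D) X.
  rewrite -(mulmx_base A); apply: H; last exact: row_base_free.
  by rewrite -row_leq_rank mxrank_tr; have := col_base_full A; rewrite -col_leq_rank.
move=> /gram_unit uC /gram_unit uD; rewrite trmxK in uC.
set iD := invmx (D *m D^T) in uD *; set iC := invmx (C^T *m C) in uC *.
have iDT : iD^T = iD by rewrite trmx_inv trmx_mul trmxK.
have iCT : iC^T = iC by rewrite trmx_inv trmx_mul trmxK.
have DiD p (Z : 'M[R]_(r, p)) : D *m (D^T *m (iD *m Z)) = Z.
  by rewrite !mulmxA mulmxV// mul1mx.
have iCC p (Z : 'M[R]_(r, p)) : iC *m (C^T *m (C *m Z)) = Z.
  by rewrite (mulmxA C^T) mulmxA mulVmx// mul1mx.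
set X := D^T *m iD *m iC *m C^T.
have AX : C *m D *m X = C *m iC *m C^T by rewrite /X -!mulmxA DiD.
have XA : X *m (C *m D) = D^T *m iD *m D by rewrite /X -!mulmxA iCC.
exists X; split; rewrite ?XA ?AX.
- by rewrite -!mulmxA iCC.
- by rewrite /X -!mulmxA DiD.
- by rewrite !trmx_mul trmxK iCT mulmxA.
- by rewrite !trmx_mul trmxK iDT mulmxA.
Qed.

Lemma penrose_uniq m n (A : 'M[R]_(m, n)) X Y :
  penrose A X -> penrose A Y -> X = Y.
Proof.
move=> [x1 x2 x3 x4] [y1 y2 y3 y4].
have e1 : A *m X = A *m Y.
  have e : A *m Y *m (A *m X) = A *m X by rewrite mulmxA y1.
  by rewrite -x3 -e trmx_mul x3 y3 mulmxA x1.
have e2 : X *m A = Y *m A.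
  have e : X *m A *m (Y *m A) = X *m A by rewrite -mulmxA (mulmxA A) y1.
  by rewrite -x4 -e trmx_mul x4 y4 -mulmxA (mulmxA A) x1.
by rewrite -x2 e2 -mulmxA e1 mulmxA y2.
Qed.

Lemma mpinvP m n (A : 'M[R]_(m, n)) : penrose A (mpinv A).
Proof. by have [X AX] := penrose_exist A; exact: (@xgetI _ _ _ X). Qed.

End PseudoInverse.

Section GaussianMatrices.
Context {d : measure_display} {T : measurableType d} {R : realType}.
Variable P : probability T R.

Definition mutually_independent (I : choiceType) (F : I -> set (set T)) : Prop :=
  forall (J : {fset I}) (E : I -> set T), (forall i, i \in J -> F i (E i)) ->
    P (\bigcap_(i in [set` J]) E i) = (\prod_(i <- J) P (E i))%E.

Definition sigma_of_rv (X : T -> R) : set (set T) :=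
  preimage_set_system setT X measurable.

Definition sigma_of_mx k m (S : T -> 'M[R]_(k, m)) : set (set T) :=
  <<s \bigcup_(ij in [set: 'I_k * 'I_m]) sigma_of_rv (fun w => S w ij.1 ij.2) >>.

Definition standard_normal (X : T -> R) : Prop :=
  measurable_fun setT X /\
  forall B, measurable B -> pushforward P X B = normal_prob 0 1 B.

Definition gaussian_matrix k m (S : T -> 'M[R]_(k, m)) : Prop :=
  (forall i j, standard_normal (fun w => S w i j)) /\
  mutually_independent
    (fun ij : 'I_k * 'I_m => sigma_of_rv (fun w => S w ij.1 ij.2)).

(* Identical distribution of the copies is automatic. *)
Definition iid_gaussian_matrices k m (S : nat -> T -> 'M[R]_(k, m)) : Prop :=
  (forall t, gaussian_matrix (S t)) /\
  mutually_independent (fun t => sigma_of_mx (S t)).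

End GaussianMatrices.

Section SketchAndProject.
Variable R : realType.

Fixpoint sketch_project m n k (A : 'M[R]_(m, n)) (b : 'cV[R]_m)
    (S : nat -> 'M[R]_(k, m)) (x0 : 'cV[R]_n) (t : nat) : 'cV[R]_n :=
  if t is u.+1 then
    let x := sketch_project A b S x0 u in
    x - mpinv (S u *m A) *m S u *m (A *m x - b)
  else x0.

End SketchAndProject.

(* Main.v *)
(** Write Pi = E[P] for the mean of the orthogonal projection P onto the row
    space of S A, and v_1, ..., v_n for right singular vectors of A. One step of
    the iteration replaces the error e by (1 - P) e, and e is independent of P,
    so it suffices to bound Pi below by k / (2 c^2 n).

    The law of S is invariant under S |-> S H for every reflection H. Reflecting
    along a left singular vector flips the sign of one v_i, so Pi is diagonal in
    the basis (v_i). The reflection exchanging two left singular vectors compares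
    the diagonal entries of Pi: since
      <v, P v> = max_y (2 <y, S A v> - |(S A)^T y|^2)
    is monotone in S A A^T S^T, every entry is at least c^-2 times any entry of
    index >= r. The trace of P is almost surely k, and the first r - 1 entries
    contribute at most r - 1 <= k / 2 of it, so the others sum to at least k / 2. *)

Require Import Defs.
From HB Require Import structures.
From mathcomp Require Import all_boot all_order all_algebra.
From mathcomp Require Import finmap all_classical all_reals all_analysis.
From mathcomp Require Import measurable_realfun.
From mathcomp Require Import zify ring lra.

Set Implicit Arguments.
Unset Strict Implicit.
Unset Printing Implicit Defensive.

Import Order.TTheory GRing.Theory Num.Theory.
Import numFieldNormedType.Exports.
Local Open Scope classical_set_scope.
Local Open Scope ring_scope.

(** * Independence *)

Section Independence.
Local Open Scope ereal_scope.
Context {d : measure_display} {T : measurableType d} {R : realType}.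
Variable P : probability T R.
Implicit Types G F : set (set T).

(** Invariance of the law of [S] rests on one operation: integrating out a single entry while the
    others are frozen. It reduces a rotation of two columns to a rotation of two entries of one row,
    hence to the Gaussian measure of the plane, and a sign change of a column to the symmetry of
    N(0,1). Every reflection is conjugate, by such rotations, to a sign change.

    The comparison of diagonal entries is an inequality because exchanging two left singular vectors
    does not exchange the corresponding [v_i] unless their singular values agree. One factor [c]
    pays for the change of the Gram matrix S A A^T S^T under the reflection, the other for the ratio
    of the squared norms of A v_j and A v_i. The factor 2 in the constant is the half of the trace
    left to the tail.

    The pseudoinverse is a discontinuous function of the matrix, so even the measurability of P
    needs an argument: P is a pointwise limit of regularized expressions. Only the quadratic form of
    Pi is used, never its off-diagonal entries. *)

Definition indep_systems F G :=
  forall A B, F A -> G B -> P (A `&` B) = P A * P B.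

Lemma indep_systems_sym F G : indep_systems F G -> indep_systems G F.
Proof. by move=> FG A B GA FB; rewrite setIC muleC FG. Qed.

(** For fixed [B], the finite measures P(A [&] B) and P(A) P(B) in [A] agree on the pi-system [G],
    which contains the whole space, hence on the sigma-algebra it generates. *)
Lemma indep_systems_sigmal G F : G `<=` measurable -> F `<=` measurable ->
  setI_closed G -> G setT -> indep_systems G F -> indep_systems <<s G >> F.
Proof.
move=> mG mF GI GT GF A B sA FB; have mB := mF _ FB.
have PBf : P B \is a fin_num by exact: fin_num_measure.
have r0 : (0 <= fine (P B))%R by exact/fine_ge0/measure_ge0.
transitivity (mrestr P mB A); first by [].
rewrite (@g_sigma_algebra_measure_unique _ _ _ G mG (fun=> setT) _ _
  (mrestr P mB) (mscale (NngNum r0) P)) //.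
- by transitivity ((fine (P B))%:E * P A) => //; rewrite fineK// muleC.
- by rewrite bigcup_const.
- move=> C GC; transitivity ((fine (P B))%:E * P C) => //.
  by rewrite fineK// muleC; exact: GF.
- by move=> k; change (P (setT `&` B) < +oo); rewrite setTI ltey_eq PBf.
Qed.

Lemma g_sigma_sub G : G `<=` measurable -> <<s G >> `<=` measurable.
Proof. by move=> mG; apply: smallest_sub => //; exact: sigma_algebra_measurable. Qed.

Lemma indep_systems_sigma G1 G2 : G1 `<=` measurable -> G2 `<=` measurable ->
  setI_closed G1 -> setI_closed G2 -> G1 setT -> G2 setT ->
  indep_systems G1 G2 -> indep_systems <<s G1 >> <<s G2 >>.
Proof.
move=> m1 m2 I1 I2 T1 T2 G12.
apply: indep_systems_sigmal => //; first exact: g_sigma_sub.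
apply: indep_systems_sym; apply: indep_systems_sigmal => //.
exact: indep_systems_sym.
Qed.

(* Both arguments of f range over the same underlying set T, but each is measured
   by its own sub-sigma-algebra; this replaces joint laws of random elements. *)
Lemma decoupling G1 G2 (f : T -> T -> \bar R) :
  G1 `<=` measurable -> G2 `<=` measurable ->
  indep_systems <<s G1 >> <<s G2 >> ->
  measurable_fun [set: g_sigma_algebraType G1 * g_sigma_algebraType G2]
    (fun w => f w.1 w.2) ->
  (forall x y, 0 <= f x y) ->
  \int[P]_w f w w = \int[P]_w1 \int[P]_w2 f w1 w2.
Proof.
move=> mG1 mG2 ind mf f0.
have mi (G : set (set T)) : G `<=` measurable ->
    measurable_fun setT (idfun : T -> g_sigma_algebraType G).
  by move=> mG _ B mB; rewrite setTI; exact: (g_sigma_sub mG).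
pose X1 : {mfun T >-> g_sigma_algebraType G1} :=
  HB.pack (idfun : T -> g_sigma_algebraType G1)
    (isMeasurableFun.Build _ _ _ _ _ (mi _ mG1)).
pose X2 : {mfun T >-> g_sigma_algebraType G2} :=
  HB.pack (idfun : T -> g_sigma_algebraType G2)
    (isMeasurableFun.Build _ _ _ _ _ (mi _ mG2)).
have mphi : measurable_fun setT
    (fun w : T => (w, w) : g_sigma_algebraType G1 * g_sigma_algebraType G2).
  by apply: measurable_fun_pair; [exact: (mi _ mG1)|exact: (mi _ mG2)].
pose X12 : {mfun T >-> (g_sigma_algebraType G1 * g_sigma_algebraType G2)%type} :=
  HB.pack (fun w : T => (w, w) : g_sigma_algebraType G1 * g_sigma_algebraType G2)
    (isMeasurableFun.Build _ _ _ _ _ mphi).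
pose g := fun w : g_sigma_algebraType G1 * g_sigma_algebraType G2 => f w.1 w.2.
have g0 w : 0 <= g w by exact: f0.
rewrite -[LHS](ge0_integral_distribution X12 mf g0).
(* By independence, the law of the diagonal map from [w] to [(w, w)] agrees with the product of the
   two restrictions of [P] on rectangles, so they are equal and Tonelli applies. *)
transitivity (\int[distribution P X1 \x distribution P X2]_z g z).
  apply: eq_measure_integral => A mA _.
  have := @product_measure_unique _ _ _ _ _ (distribution P X1)
    (distribution P X2) (distribution P X12) _ A mA.
  move=> prodE; apply/esym; apply: prodE => B C mB mC.
  by rewrite /distribution /pushforward -ind.
rewrite fubini_tonelli1// ge0_integral_distribution//; last 2 first.
- exact: measurable_fun_fubini_tonelli_F.
- by move=> y; apply: integral_ge0.
apply: eq_integral => w1 _ /=; rewrite /fubini_F ge0_integral_distribution//.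
by apply: (measurableT_comp (f := g)) => //; exact: pair1_measurable.
Qed.

End Independence.

(** * Independence of disjoint groups of a family *)

Section Grouping.
Local Open Scope ereal_scope.
Context {d : measure_display} {T : measurableType d} {R : realType}.
Variables (P : probability T R) (I : choiceType) (F : I -> set (set T)).
Hypothesis mF : forall i, F i `<=` measurable.
Hypothesis FI : forall i, setI_closed (F i).
Hypothesis FT : forall i, F i setT.

(** A pi-system generating the joint sigma-algebra of the [F i] with [i] in [J]. [E] is total and
    constrained at every index, so two cylinders are merged index by index, with [setT] as the
    default. *)
Definition cylinders (J : set I) : set (set T) :=
  [set A | exists (D : {fset I}) (E : I -> set T),
    [/\ [set` D] `<=` J, (forall i, F i (E i)) &
        A = \bigcap_(i in [set` D]) E i]].

Lemma cylindersT J : cylinders J setT.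
Proof.
exists fset0, (fun=> setT); split => //.
by apply/seteqP; split.
Qed.

Lemma sub_cylinders J i A : J i -> F i A -> cylinders J A.
Proof.
move=> Ji FA; exists [fset i]%fset, (fun j => if j == i then A else setT); split.
- by move=> j /=; rewrite inE => /eqP ->.
- by move=> j; case: eqP => [->//|_]; exact: FT.
- apply/seteqP; split=> [x Ax j /=|x /(_ i) /=].
    by rewrite inE => ->.
  by rewrite inE eqxx; exact.
Qed.

Lemma cylinders_measurable J : cylinders J `<=` measurable.
Proof.
move=> _ [D [E [_ FE ->]]]; apply: fin_bigcap_measurable => // i _.
exact: mF (FE i).
Qed.

Lemma cylindersI J : setI_closed (cylinders J).
Proof.
move=> _ _ [D1 [E1 [J1 F1 ->]]] [D2 [E2 [J2 F2 ->]]].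
exists (D1 `|` D2)%fset, (fun i => (if i \in D1 then E1 i else setT)
  `&` (if i \in D2 then E2 i else setT)); split.
- by move=> i /=; rewrite in_fsetU => /orP[/J1|/J2].
- by move=> i; apply: FI; case: ifP.
- apply/seteqP; split=> [x [x1 x2] i /= _|x x12].
    by split; case: ifP => // iD; [exact: x1|exact: x2].
  by split=> i iD; have := x12 i; rewrite /= in_fsetU iD ?orbT => /(_ isT)[].
Qed.

Hypothesis indF : mutually_independent P F.

(** Disjoint groups have disjoint finite supports, so the product formula over the union of the
    supports splits in two. It serves to separate one entry of a sketch from the others, and one
    sketch from all earlier ones. *)
Lemma cylinders_indep J1 J2 : J1 `&` J2 = set0 ->
  indep_systems P <<s cylinders J1 >> <<s cylinders J2 >>.
Proof.
move=> J12; apply: indep_systems_sigma;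
  do ?[exact: cylinders_measurable|exact: cylindersI|exact: cylindersT].
move=> _ _ [D1 [E1 [D1J F1 ->]]] [D2 [E2 [D2J F2 ->]]].
have D12 i : i \in D1 -> i \in D2 -> False.
  by move=> /D1J J1i /D2J J2i; suff : (J1 `&` J2) i by rewrite J12.
pose E i := if i \in D1 then E1 i else E2 i.
have FE i : F i (E i) by rewrite /E; case: ifP.
have eD1 i : i \in D1 -> E i = E1 i by rewrite /E => ->.
have eD2 i : i \in D2 -> E i = E2 i.
  by rewrite /E => iD2; case: ifP => // /D12 /(_ iD2).
have -> : \bigcap_(i in [set` D1]) E1 i `&` \bigcap_(i in [set` D2]) E2 i =
    \bigcap_(i in [set` (D1 `|` D2)%fset]) E i.
  apply/seteqP; split=> [x [x1 x2] i /=|x x12].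
    rewrite in_fsetU => /orP[] iD; first by rewrite eD1//; exact: x1.
    by rewrite eD2//; exact: x2.
  by split=> i /= iD; [rewrite -eD1//|rewrite -eD2//]; apply: x12;
    rewrite /= in_fsetU iD ?orbT.
rewrite !indF//.
have /(perm_big _) -> : perm_eq (D1 `|` D2)%fset (D1 ++ D2).
  apply: uniq_perm.
  - exact: fset_uniq.
  - rewrite cat_uniq !fset_uniq/= andbT; apply/hasPn => i iD2.
    by apply/negP => /D12/(_ iD2).
  - by move=> i; rewrite in_fsetU mem_cat.
rewrite big_cat/=; congr (_ * _); rewrite big_seq [RHS]big_seq.
  by apply: eq_bigr => i iD; rewrite eD1.
by apply: eq_bigr => i iD; rewrite eD2.
Qed.

End Grouping.

(** * Rotation invariance of the Gaussian law *)

Section GaussianPlane.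
Local Open Scope ereal_scope.
Context {R : realType}.
Notation mu := (@lebesgue_measure R).
Notation gauss := (@normal_prob R 0 1).

Lemma ge0_integral_shift (f : R -> \bar R) (a : R) : measurable_fun setT f ->
  (forall x, 0 <= f x) -> \int[mu]_x f (x + a)%R = \int[mu]_x f x.
Proof.
move=> mf f0.
have ma : measurable_fun setT
    ((fun x => x + a)%R : measurableTypeR R -> measurableTypeR R).
  exact: measurable_funD.
transitivity (\int[pushforward mu
    ((fun x => x + a)%R : measurableTypeR R -> measurableTypeR R)]_x f x).
  by rewrite ge0_integral_pushforward.
apply: eq_measure_integral => /= A mA _; apply/esym.
apply: lebesgue_measure_unique => //= _ [[u v]] _ <-; rewrite /pushforward.
rewrite [X in _ = mu X](_ : _ = `]u - a, v - a]%classic)%R; last first.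
  by apply/seteqP; split => x /=; rewrite !in_itv/= ltrBlDr lerBrDr.
rewrite !lebesgue_measure_itv/= !lte_fin ltrD2r -!EFinB.
by case: ifP => // _; congr (_%:E); lra.
Qed.

Lemma ge0_integral_opp (f : R -> \bar R) : measurable_fun setT f ->
  (forall x, 0 <= f x) -> \int[mu]_x f (- x)%R = \int[mu]_x f x.
Proof.
move=> mf f0.
transitivity (\int[pushforward mu
    (-%R : measurableTypeR R -> measurableTypeR R)]_x f x).
  by rewrite ge0_integral_pushforward.
by apply: eq_measure_integral => /= A mA _; exact: lebesgue_measureN.
Qed.

Lemma ge0_integral_gauss (f : R -> \bar R) : measurable_fun setT f ->
  (forall x, 0 <= f x) ->
  \int[gauss]_x f x = \int[mu]_x (f x * (normal_pdf 0 1 x)%:E).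
Proof.
move=> mf f0.
have dom : gauss `<< mu by exact: normal_prob_dominates.
have mpdf : measurable_fun setT (EFin \o @normal_pdf R 0 1).
  by apply/measurable_EFinP; exact: measurable_normal_pdf.
rewrite -(Radon_Nikodym_SigmaFinite.change_of_variables dom f0)//.
have iRN := Radon_Nikodym_SigmaFinite.f_integrable dom.
apply: ae_eq_integral => //.
- by apply: emeasurable_funM => //; exact: measurable_int iRN.
- exact: emeasurable_funM.
(* The Radon-Nikodym derivative and [normal_pdf] have the same integral over every measurable set,
   hence agree almost everywhere. *)
- apply: ae_eqe_mul2l; apply: integral_ae_eq => //= A _ mA.
  by rewrite -Radon_Nikodym_SigmaFinite.f_integral.
Qed.

Lemma ge0_integral_gaussN (f : R -> \bar R) : measurable_fun setT f ->
  (forall x, 0 <= f x) -> \int[gauss]_x f (- x)%R = \int[gauss]_x f x.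
Proof.
move=> mf f0.
rewrite !ge0_integral_gauss//; last exact: measurableT_comp.
have <- := @ge0_integral_opp (fun x => f x * (normal_pdf 0 1 x)%:E); last 2 first.
- apply: emeasurable_funM => //; apply/measurable_EFinP.
  exact: measurable_normal_pdf.
- by move=> x; rewrite mule_ge0// lee_fin normal_pdf_ge0.
apply: eq_integral => x _; congr (_ * (_)%:E).
by rewrite !normal_pdfE ?oner_eq0//= /normal_fun !subr0 sqrrN.
Qed.

Let plane (h : R -> R -> \bar R) := \int[mu]_x \int[mu]_y h x y.
Let mplane (h : R -> R -> \bar R) :=
  measurable_fun [set: R * R] (fun z => h z.1 z.2).

Let mplane_comp (h : R -> R -> \bar R) (f g : R * R -> R) : mplane h ->
  measurable_fun setT f -> measurable_fun setT g ->
  measurable_fun setT (fun z => h (f z) (g z)).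
Proof.
move=> mh mf mg.
by apply: (measurableT_comp mh (g := fun z => (f z, g z))); exact: measurable_fun_pair.
Qed.

Let mplane_x (h : R -> R -> \bar R) x : mplane h -> measurable_fun setT (h x).
Proof.
by move=> mh; exact: (measurableT_comp (f := fun z : R * R => h z.1 z.2) mh
  (pair1_measurable x)).
Qed.

Let plane_swap h : mplane h -> (forall x y, 0 <= h x y) ->
  plane h = plane (fun x y => h y x).
Proof. 
move=> mh h0.
exact: (@fubini_tonelli _ _ (measurableTypeR R) (measurableTypeR R) R mu mu
  (fun z => h z.1 z.2) mh (fun z => h0 z.1 z.2)).
Qed.

Let plane_shear h a : mplane h -> (forall x y, 0 <= h x y) ->
  plane (fun x y => h x (y + a * x)%R) = plane h.
Proof.
move=> mh h0; apply: eq_integral => x _; apply: ge0_integral_shift => //.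
exact: mplane_x.
Qed.

Let maffine (f g : R * R -> R) a : measurable_fun setT f ->
  measurable_fun setT g -> measurable_fun setT (fun z => f z + a * g z)%R.
Proof. by move=> mf mg; apply: measurable_funD => //; exact: measurable_funM. Qed.

Let plane_shear' h a : mplane h -> (forall x y, 0 <= h x y) ->
  plane (fun x y => h (x + a * y)%R y) = plane h.
Proof.
move=> mh h0.
have mh' : mplane (fun x y => h (x + a * y)%R y).
  exact: (mplane_comp mh (maffine a measurable_fst measurable_snd) measurable_snd).
have mhs : mplane (fun x y => h y x).
  exact: (mplane_comp mh measurable_snd measurable_fst).
transitivity (plane (fun x y => h (y + a * x)%R x)); first exact: plane_swap.
transitivity (plane (fun x y => h y x)); last exact/esym/plane_swap.
exact: (plane_shear (h := fun x y => h y x)).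
Qed.

(* A rotation of angle not in {0, pi} is a product of three shears. *)
Let plane_rotation h (c s : R) : (s != 0)%R -> (c ^+ 2 + s ^+ 2 = 1)%R ->
  mplane h -> (forall x y, 0 <= h x y) ->
  plane (fun x y => h (c * x - s * y) (s * x + c * y))%R = plane h.
Proof.
(* With [c] and [s] the cosine and sine of an angle, [a] is minus the tangent of half that angle.
   The shears are, in this order, x + a y, then y + s x, then x + a y again. *)
move=> s0 cs mh h0; pose a := ((c - 1) / s)%R.
have sa : (s * a = c - 1)%R by rewrite /a mulrC divfK.
have ac : (a * (c + 1) = - s)%R.
  by apply: (mulfI s0); rewrite mulrA sa; lra.
pose h1 x y := h (x + a * y)%R y; pose h2 x y := h1 x (y + s * x)%R.
have mh1 : mplane h1.
  exact: (mplane_comp mh (maffine a measurable_fst measurable_snd) measurable_snd).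
have mh2 : mplane h2.
  exact: (mplane_comp mh1 measurable_fst (maffine s measurable_snd measurable_fst)).
transitivity (plane (fun x y => h2 (x + a * y)%R y)).
  apply: eq_integral => x _; apply: eq_integral => y _.
  have e : (s * x + c * y = y + s * (x + a * y))%R by rewrite mulrDr mulrA sa; ring.
  rewrite /h2 /h1 -e; congr h.
  have -> : (x + a * y + a * (s * x + c * y) =
    x + (s * a) * x + (a * (c + 1)) * y)%R by ring.
  by rewrite sa ac; ring.
transitivity (plane h2); first exact: (plane_shear' a mh2 (fun _ _ => h0 _ _)).
transitivity (plane h1); first exact: (plane_shear s mh1 (fun _ _ => h0 _ _)).
exact: plane_shear'.
Qed.

(** The joint density depends on x^2 + y^2 only, so the rotation invariance of Lebesgue measure in
    the plane carries over. *)
Lemma gauss_rotation (h : R -> R -> \bar R) (c s : R) : (s != 0)%R ->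
  (c ^+ 2 + s ^+ 2 = 1)%R ->
  measurable_fun [set: R * R] (fun z => h z.1 z.2) ->
  (forall x y, 0 <= h x y) ->
  \int[gauss]_x \int[gauss]_y h (c * x - s * y)%R (s * x + c * y)%R =
  \int[gauss]_x \int[gauss]_y h x y.
Proof.
move=> s0 cs.
pose w (x y : R) := (normal_pdf 0 1 y)%:E * (normal_pdf 0 1 x : R)%:E.
have wE x y : w x y = (normal_peak 1 * normal_peak 1 *
    expR (- (x ^+ 2 + y ^+ 2) / (1 ^+ 2 *+ 2)))%:E.
  rewrite /w -EFinM !normal_pdfE ?oner_eq0// mulrACA -expRD !subr0.
  by congr (_ * expR _)%:E; rewrite -mulrDl; congr (_ / _)%R; ring.
have mpdf : measurable_fun setT (EFin \o @normal_pdf R 0 1).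
  by apply/measurable_EFinP; exact: measurable_normal_pdf.
have w0 x y : 0 <= w x y by rewrite mule_ge0// lee_fin normal_pdf_ge0.
have mw : mplane w.
  by apply: emeasurable_funM; apply: (measurableT_comp mpdf).
have E g : mplane g -> (forall x y, 0 <= g x y) ->
    \int[gauss]_x \int[gauss]_y g x y = plane (fun x y => g x y * w x y).
  move=> mg g0.
  have mgx x : measurable_fun setT (g x) by exact: mplane_x.
  rewrite ge0_integral_gauss//; last 2 first.
  - exact: (measurable_fun_fubini_tonelli_F (m2 := gauss) (fun z => g z.1 z.2)).
  - by move=> x; apply: integral_ge0.
  apply: eq_integral => x _; rewrite ge0_integral_gauss//.
  rewrite -ge0_integralZr//.
  - by apply: eq_integral => y _; rewrite muleA.
  - exact: (emeasurable_funM (mgx x) mpdf).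
  - by move=> y _; rewrite mule_ge0// lee_fin normal_pdf_ge0.
  - by rewrite lee_fin normal_pdf_ge0.
move=> mh h0.
have mh' : mplane (fun x y => h (c * x - s * y)%R (s * x + c * y)%R).
  apply: (@mplane_comp _ (fun z => c * z.1 - s * z.2)%R
    (fun z => s * z.1 + c * z.2)%R mh).
  - by apply: measurable_funB; apply: measurable_funM.
  - by apply: measurable_funD; apply: measurable_funM.
have mhw : mplane (fun x y => h x y * w x y) by exact: emeasurable_funM.
transitivity (plane (fun x y => h (c * x - s * y)%R (s * x + c * y)%R * w x y)).
  by apply: (E _ mh') => x y; exact: h0.
transitivity (plane (fun x y => h x y * w x y)); last exact/esym/(E _ mh).
rewrite -(plane_rotation s0 cs mhw) => [|x y]; last exact: mule_ge0.
apply: eq_integral => x _; apply: eq_integral => y _; congr (_ * _).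
rewrite !wE; congr (_ * expR _)%:E.
transitivity (- ((c ^+ 2 + s ^+ 2) * (x ^+ 2 + y ^+ 2)) / (1 ^+ 2 *+ 2))%R.
  by rewrite cs mul1r.
by congr (- _ / _)%R; ring.
Qed.

End GaussianPlane.

(** * Borel functions of a random matrix and resampling of one entry *)

Section BorelMatrix.
Context {R : realType}.

Definition mx_measurable d (T : measurableType d) k m (S : T -> 'M[R]_(k, m)) :=
  forall i j, measurable_fun setT (fun w => S w i j).

(* Borel measurability of f, without a sigma-algebra on matrices. *)
Definition mx_borel k m (f : 'M[R]_(k, m) -> \bar R) :=
  forall d (T : measurableType d) (S : T -> 'M[R]_(k, m)),
    mx_measurable S -> measurable_fun setT (fun w => f (S w)).

Definition upd k m (M : 'M[R]_(k, m)) i0 j0 (x : R) : 'M[R]_(k, m) :=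
  \matrix_(i, j) if (i == i0) && (j == j0) then x else M i j.

Lemma upd_id k m (M : 'M[R]_(k, m)) i j : upd M i j (M i j) = M.
Proof. by apply/matrixP => a b; rewrite mxE; case: andP => // -[/eqP-> /eqP->]. Qed.

Lemma upd_measurable d (T : measurableType d) k m (S : T -> 'M[R]_(k, m))
    (x : T -> R) i0 j0 :
  (forall i j, ~~ ((i == i0) && (j == j0)) ->
     measurable_fun setT (fun w => S w i j)) ->
  measurable_fun setT x -> mx_measurable (fun w => upd (S w) i0 j0 (x w)).
Proof.
move=> mS mx i j; under eq_fun do rewrite mxE.
by case: (boolP ((i == i0) && (j == j0))) => // ij; exact: mS.
Qed.

End BorelMatrix.

Section Resampling.
Local Open Scope ereal_scope.
Context {d : measure_display} {T : measurableType d} {R : realType}.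
Variables (P : probability T R) (k m : nat) (S : T -> 'M[R]_(k, m)).
Hypothesis gS : gaussian_matrix P S.
Notation gauss := (@normal_prob R 0 1).

Lemma gaussian_mx_measurable : mx_measurable S.
Proof. by move=> i j; have [+ _] := gS => /(_ i j)[]. Qed.

Lemma sigma_of_rv_measurable (X : T -> R) :
  measurable_fun setT X -> sigma_of_rv X `<=` measurable.
Proof. by move=> mX _ [B mB <-]; exact: mX. Qed.

Lemma sigma_of_rvI (X : T -> R) : setI_closed (sigma_of_rv X).
Proof.
move=> _ _ [A mA <-] [B mB <-]; exists (A `&` B); first exact: measurableI.
by rewrite !setTI preimage_setI.
Qed.

Lemma sigma_of_rvT (X : T -> R) : sigma_of_rv X setT.
Proof. by exists setT => //; rewrite setTI preimage_setT. Qed.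

(** The entry at [(i0, j0)] is independent of all the others, so it may be replaced by a fresh
    normal variable. This replaces the product form of the law of [S]. *)
Lemma resample1 (f : 'M[R]_(k, m) -> \bar R) i0 j0 :
  mx_borel f -> (forall M, 0 <= f M) ->
  \int[P]_w f (S w) = \int[P]_w \int[gauss]_x f (upd (S w) i0 j0 x).
Proof.
move=> mf f0; have [stdS indS] := gS.
pose F (ij : 'I_k * 'I_m) := sigma_of_rv (fun w => S w ij.1 ij.2).
have mF ij : F ij `<=` measurable.
  exact/sigma_of_rv_measurable/gaussian_mx_measurable.
have FI ij : setI_closed (F ij) by exact: sigma_of_rvI.
have FT ij : F ij setT by exact: sigma_of_rvT.
pose J1 := [set~ (i0, j0)]; pose J2 := [set (i0, j0)].
have J12 : J1 `&` J2 = set0 by rewrite /J1 setICl.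
pose G1 := cylinders F J1; pose G2 := cylinders F J2.
have mentry (J : set ('I_k * 'I_m)) i j : J (i, j) ->
    measurable_fun [set: g_sigma_algebraType (cylinders F J)] (fun w => S w i j).
  move=> Jij _ B mB; apply: sub_sigma_algebra.
  by apply: (sub_cylinders FT Jij); exists B.
(* Writing [S w] as its own update by its own entry separates the two independent sources of
   randomness, to which [decoupling] then gives different sample points. *)
transitivity (\int[P]_w f (upd (S w) i0 j0 (S w i0 j0))).
  by apply: eq_integral => w _; rewrite upd_id.
rewrite (@decoupling _ _ _ P G1 G2 (fun v w => f (upd (S v) i0 j0 (S w i0 j0)))).
- apply: eq_integral => v _.
  have mX : measurable_fun setT (fun w => S w i0 j0 : measurableTypeR R).
    exact: gaussian_mx_measurable.
  pose X : {mfun T >-> measurableTypeR R} := HB.pack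
    (fun w => S w i0 j0 : measurableTypeR R)
    (isMeasurableFun.Build _ _ _ _ _ mX).
  have mg : measurable_fun setT
      (fun x : measurableTypeR R => f (upd (S v) i0 j0 x)).
    by apply: mf; apply: upd_measurable => // i j _; exact: measurable_cst.
  rewrite -[LHS](ge0_integral_distribution X mg)//.
  by apply: eq_measure_integral => A mA _; exact: (stdS i0 j0).2.
- exact: cylinders_measurable.
- exact: cylinders_measurable.
- exact: cylinders_indep.
- apply: (mf _ (g_sigma_algebraType G1 * g_sigma_algebraType G2)%type).
  apply: upd_measurable => [i j ij|].
    apply: (measurableT_comp (f := fun v : g_sigma_algebraType G1 => S v i j)) => //.
    by apply: mentry => -[ii jj]; move: ij; rewrite ii jj !eqxx.
  apply: (measurableT_comp (f := fun v : g_sigma_algebraType G2 => S v i0 j0)) => //.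
  exact: mentry.
- by move=> v w; exact: f0.
Qed.

(** Integrating out an entry keeps the integrand Borel, which is what allows a second entry to be
    resampled. *)
Lemma resample_borel (f : 'M[R]_(k, m) -> \bar R) i j :
  mx_borel f -> (forall M, 0 <= f M) ->
  mx_borel (fun M => \int[gauss]_x f (upd M i j x)).
Proof.
move=> mf f0 d' T' U mU.
apply: (measurable_fun_fubini_tonelli_F (m2 := gauss)
  (fun z : T' * measurableTypeR R => f (upd (U z.1) i j z.2))) => //.
apply: (mf _ (T' * measurableTypeR R)%type); apply: upd_measurable => // a b _.
exact: (measurableT_comp (mU a b)).
Qed.

End Resampling.

(** * Plane rotations and reflections as matrices *)

Section RotationMatrices.
Context {R : comNzRingType}.

(** Restricting the rotation to the rows in [r] allows an induction from one row, where only two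
    entries change, to all rows, where it is right multiplication by [givens]. *)
Definition rot_cols k m (r : seq 'I_k) (j j' : 'I_m) (c s : R) (M : 'M[R]_(k, m)) :
    'M[R]_(k, m) :=
  \matrix_(i, l) if i \in r then
      if l == j then c * M i j - s * M i j'
      else if l == j' then s * M i j + c * M i j' else M i l
    else M i l.

Definition givens m (j j' : 'I_m) (c s : R) : 'M[R]_m :=
  rot_cols (enum 'I_m) j j' c s 1%:M.

Definition flip m (j : 'I_m) : 'M[R]_m :=
  \matrix_(a, l) (if l == j then - (a == l)%:R else (a == l)%:R).

Lemma mulmx_entry_id k m (M : 'M[R]_(k, m)) i j :
  \sum_a M i a * (a == j)%:R = M i j.
Proof.
rewrite (bigD1 j)//= eqxx mulr1 big1 ?addr0// => a /negbTE ->.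
by rewrite mulr0.
Qed.

Lemma rot_colsE k m (j j' : 'I_m) c s (M : 'M[R]_(k, m)) :
  rot_cols (enum 'I_k) j j' c s M = M *m givens j j' c s.
Proof.
apply/matrixP => i l; rewrite !mxE mem_enum/=.
under eq_bigr do rewrite !mxE mem_enum/=.
case: eqP => _; [|case: eqP => _].
- under eq_bigr do rewrite mulrBr !(mulrCA (M _ _)).
  by rewrite big_split sumrN -!mulr_sumr !mulmx_entry_id.
- under eq_bigr do rewrite mulrDr !(mulrCA (M _ _)).
  by rewrite big_split -!mulr_sumr !mulmx_entry_id.
- by rewrite mulmx_entry_id.
Qed.

Lemma rot_colsK k m r (j j' : 'I_m) c s (M : 'M[R]_(k, m)) : j != j' ->
  c ^+ 2 + s ^+ 2 = 1 -> rot_cols r j j' c (- s) (rot_cols r j j' c s M) = M.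
Proof.
move=> jj' cs; apply/matrixP => i l; rewrite !mxE; case: (i \in r) => //.
have j'j : (j' == j) = false by rewrite eq_sym (negbTE jj').
rewrite !eqxx j'j /=.
have [->|lj] := eqVneq l j.
  by transitivity ((c ^+ 2 + s ^+ 2) * M i j); [ring|rewrite cs mul1r].
have [->|lj'] := eqVneq l j'; last by [].
by transitivity ((c ^+ 2 + s ^+ 2) * M i j'); [ring|rewrite cs mul1r].
Qed.

Lemma givensV m (j j' : 'I_m) c s : j != j' -> c ^+ 2 + s ^+ 2 = 1 ->
  givens j j' c s *m givens j j' c (- s) = 1%:M.
Proof. by move=> jj' cs; rewrite -rot_colsE rot_colsK. Qed.

Lemma tr_givens m (j j' : 'I_m) c s : j != j' ->
  (givens j j' c s)^T = givens j j' c (- s).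
Proof.
move=> jj'; apply/matrixP => a b; rewrite !mxE !mem_enum/=.
have j'j : (j' == j) = false by rewrite eq_sym (negbTE jj').
have [->|aj] := eqVneq a j; have [->|bj] := eqVneq b j;
  rewrite ?eqxx ?(negbTE jj') ?j'j /=; try ring.
- by case: eqVneq => _ /=; ring.
- by rewrite (eq_sym j) (negbTE aj); case: eqVneq => _ /=; ring.
rewrite (eq_sym b a).
case: (eqVneq a j') => [->|aj']; case: (eqVneq b j') => [bj'|bj'];
  rewrite ?bj' ?eqxx ?(negbTE aj') ?(eq_sym j') ?(negbTE bj') /=; try ring.
Qed.

Definition householder m (w : 'cV[R]_m) : 'M[R]_m := 1%:M - 2 *: (w *m w^T).

Lemma householder_conj m (G : 'M[R]_m) w :
  G^T *m G = 1%:M ->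
  householder w = G^T *m householder (G *m w) *m G.
Proof.
move=> GG; rewrite /householder mulmxBr mulmxBl mulmx1 GG; congr (_ - _).
rewrite -scalemxAr -scalemxAl trmx_mul.
have -> // : G^T *m (G *m w *m (w^T *m G^T)) *m G = w *m w^T.
by rewrite !mulmxA GG mul1mx -!mulmxA GG mulmx1.
Qed.

Lemma householder_tr m (w : 'cV[R]_m) : (householder w)^T = householder w.
Proof. by rewrite /householder raddfB /= trmx1 linearZ /= trmx_mul trmxK. Qed.

End RotationMatrices.

Section BorelMaps.
Context {R : realType}.

Lemma mx_measurable_mul d (T : measurableType d) k m n
    (S : T -> 'M[R]_(k, m)) (U : T -> 'M[R]_(m, n)) :
  mx_measurable S -> mx_measurable U -> mx_measurable (fun w => S w *m U w).
Proof.
move=> mS mU i j; under eq_fun do rewrite mxE.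
by apply: measurable_sum => a; apply: measurable_funM.
Qed.

Lemma mx_measurable_cst d (T : measurableType d) k m (M : 'M[R]_(k, m)) :
  mx_measurable (fun _ : T => M).
Proof. by move=> i j; exact: measurable_cst. Qed.

Lemma mx_borel_mulr k m n (Q : 'M[R]_(m, n)) (f : 'M[R]_(k, n) -> \bar R) :
  mx_borel f -> mx_borel (fun M => f (M *m Q)).
Proof.
by move=> mf d T S mS; apply: mf; apply: mx_measurable_mul => //;
  exact: mx_measurable_cst.
Qed.

Lemma mx_borel_rot k m (r : seq 'I_k) (j j' : 'I_m) (c s : R)
    (f : 'M[R]_(k, m) -> \bar R) :
  mx_borel f -> mx_borel (fun M => f (rot_cols r j j' c s M)).
Proof.
move=> mf d T S mS; apply: mf => a b; under eq_fun do rewrite mxE.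
case: (a \in r); last exact: mS.
case: (b == j); first by apply: measurable_funB; apply: measurable_funM.
case: (b == j'); last exact: mS.
by apply: measurable_funD; apply: measurable_funM.
Qed.

End BorelMaps.

(** * Right multiplications preserving the law of a Gaussian matrix *)

Section GaussianInvariance.
Local Open Scope ereal_scope.
Context {d : measure_display} {T : measurableType d} {R : realType}.
Variables (P : probability T R) (k m : nat) (S : T -> 'M[R]_(k, m)).
Hypothesis gS : gaussian_matrix P S.
Notation gauss := (@normal_prob R 0 1).

Definition law_invariant (phi : 'M[R]_(k, m) -> 'M[R]_(k, m)) :=
  forall f, mx_borel f -> (forall M, 0 <= f M) ->
    \int[P]_w f (phi (S w)) = \int[P]_w f (S w).

Lemma law_invariant_rot1 i j j' c s : j != j' -> s != 0%R ->
  (c ^+ 2 + s ^+ 2 = 1)%R -> law_invariant (rot_cols [:: i] j j' c s).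
Proof.
move=> jj' s0 cs.
have E f : mx_borel f -> (forall M, 0 <= f M) -> \int[P]_w f (S w) =
    \int[P]_w \int[gauss]_y \int[gauss]_x f (upd (upd (S w) i j' y) i j x).
  move=> mf f0; rewrite (resample1 gS i j mf f0).
  have g0 M : 0 <= \int[gauss]_x f (upd M i j x) by exact: integral_ge0.
  exact: (resample1 gS i j' (resample_borel i j mf f0) g0).
move=> f mf f0.
rewrite (E _ (mx_borel_rot _ _ _ _ _ mf) (fun=> f0 _)) [RHS](E _ mf f0).
apply: eq_integral => w _.
pose h y x := f (upd (upd (S w) i j' y) i j x).
(* The outer integration variable of [h] is the entry in column [j'], the inner one that in column
   [j]; in this order the rotation has sine [- s]. *)
have s0' : (- s != 0)%R by rewrite oppr_eq0.
have cs' : (c ^+ 2 + (- s) ^+ 2 = 1)%R by rewrite sqrrN.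
rewrite -[RHS](gauss_rotation (h := h) s0' cs').
- apply: eq_integral => y _; apply: eq_integral => x _; congr f.
  apply/matrixP => a b; rewrite !mxE !inE !eqxx.
  have j'j : (j' == j) = false by rewrite eq_sym (negbTE jj').
  rewrite !(negbTE jj') j'j; case: eqP => //= _.
  by case: eqP => _; [ring|case: eqP => // _; ring].
- apply: (mf _ (R * R)%type); apply: upd_measurable => // a b _.
  by apply: upd_measurable => // a' b' _; exact: measurable_cst.
- by move=> x y; exact: f0.
Qed.

Lemma law_invariant_givens j j' c s : j != j' -> s != 0%R ->
  (c ^+ 2 + s ^+ 2 = 1)%R -> law_invariant (mulmxr (givens j j' c s)).
Proof.
move=> jj' s0 cs.
suff H r : uniq r -> law_invariant (rot_cols r j j' c s).
  move=> f mf f0 /=; rewrite -(H _ (enum_uniq 'I_k))//.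
  by apply: eq_integral => w _; rewrite rot_colsE.
elim: r => [_ f mf f0|i r IH /= /andP[ir ur] f mf f0].
  by apply: eq_integral => w _; congr f; apply/matrixP => a b; rewrite mxE.
have H M : rot_cols (i :: r) j j' c s M =
    rot_cols r j j' c s (rot_cols [:: i] j j' c s M).
  apply/matrixP => a b; rewrite !mxE !inE.
  case: eqVneq => [->|_]; last by case: (a \in r).
  by rewrite /= (negbTE ir).
under eq_integral do rewrite H.
rewrite (@law_invariant_rot1 i j j' c s jj' s0 cs
  (fun M => f (rot_cols r j j' c s M)))//; last exact: mx_borel_rot.
exact: IH.
Qed.

Lemma law_invariant_flip j : law_invariant (mulmxr (flip j)).
Proof.
pose fl (r : seq 'I_k) (M : 'M[R]_(k, m)) : 'M[R]_(k, m) :=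
  \matrix_(a, b) if (a \in r) && (b == j) then (- M a b)%R else M a b.
have mfl r f : mx_borel f -> mx_borel (fun M => f (fl r M)).
  move=> mf d' T' S' mS; apply: mf => a b; under eq_fun do rewrite mxE.
  by case: ((a \in r) && (b == j)); [exact: measurable_funN|exact: mS].
suff H r : uniq r -> law_invariant (fl r).
  move=> f mf f0 /=; rewrite -(H _ (enum_uniq 'I_k))//.
  apply: eq_integral => w _; congr f; apply/matrixP => a b.
  rewrite !mxE mem_enum/=; under eq_bigr do rewrite mxE.
  case: eqP => _; last exact: mulmx_entry_id.
  by under eq_bigr do rewrite mulrN; rewrite sumrN mulmx_entry_id.
elim: r => [_ f mf f0|i r IH /= /andP[ir ur] f mf f0].
  by apply: eq_integral => w _; congr f; apply/matrixP => a b; rewrite mxE.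
have H M : fl (i :: r) M = fl r (fl [:: i] M).
  apply/matrixP => a b; rewrite !mxE !inE.
  case: eqVneq => [->|_]; last by case: (a \in r).
  by rewrite /= (negbTE ir).
under eq_integral do rewrite H.
rewrite -(IH ur f)//; have mg := mfl r f mf.
rewrite [LHS](resample1 gS i j (mfl [:: i] _ mg) (fun=> f0 _)).
rewrite [RHS](resample1 gS i j mg (fun=> f0 _)).
apply: eq_integral => w _.
rewrite -[RHS]ge0_integral_gaussN//; last first.
  by apply: mg; apply: upd_measurable => // a b _; exact: measurable_cst.
apply: eq_integral => x _; congr (f (fl _ _)).
apply/matrixP => a b; rewrite !mxE inE.
case: eqP => //= ->.
by case: (b == j).
Qed.

Lemma law_invariantM Q Q' : law_invariant (mulmxr Q) ->
  law_invariant (mulmxr Q') -> law_invariant (mulmxr (Q *m Q')).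
Proof.
move=> iQ iQ' f mf f0 /=; under eq_integral do rewrite mulmxA.
by rewrite (iQ (fun M => f (M *m Q')))// ?iQ'//; exact: mx_borel_mulr.
Qed.

End GaussianInvariance.

Section HouseholderInvariance.
Context {d : measure_display} {T : measurableType d} {R : realType}.
Variables (P : probability T R) (k m : nat) (S : T -> 'M[R]_(k, m)).
Hypothesis gS : gaussian_matrix P S.

(** Induction on the number of nonzero coordinates of [w]. If two are nonzero, a rotation [G] in
    their plane annihilates one of them, and the reflection along [w] is the conjugate by [G] of the
    reflection along [G *m w]. If only one is nonzero, it is 1 or -1 and the reflection is a sign
    flip of a coordinate. *)
Lemma law_invariant_householder (w : 'cV[R]_m) : w^T *m w = 1%:M ->
  law_invariant P S (mulmxr (householder w)).
Proof.
have [N] := ubnP #|[pred j | w j 0 != 0]|.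
elim: N w => // N IH w + w1.
have w11 : (\sum_j w j 0 ^+ 2 = 1).
  move/matrixP/(_ 0 0): w1; rewrite !mxE eqxx mulr1n => <-.
  by apply: eq_bigr => j _; rewrite mxE expr2.
have [j wj] : exists j, w j 0 != 0.
  apply/existsP; rewrite -[X in is_true X]negbK negb_exists.
  apply/negP => /forallP w0; move: w11; rewrite big1.
    by move/eqP; rewrite eq_sym oner_eq0.
  by move=> j _; have := w0 j; rewrite negbK => /eqP->; rewrite expr0n.
have [[j' /andP[jj' wj']] wN|] := pselect (exists j', (j != j') && (w j' 0 != 0)).
  pose rho := Num.sqrt (w j 0 ^+ 2 + w j' 0 ^+ 2).
  have rho2 : (rho ^+ 2 = w j 0 ^+ 2 + w j' 0 ^+ 2).
    by rewrite sqr_sqrtr// addr_ge0// sqr_ge0.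
  have rho0 : rho != 0.
    rewrite -sqrf_eq0 rho2 gt_eqF// ltr_pwDl ?sqr_ge0//.
    by rewrite exprn_even_gt0.
  pose c := (w j 0 / rho); pose s := (w j' 0 / rho).
  have s0 : s != 0 by rewrite mulf_neq0// invr_eq0.
  have cs : (c ^+ 2 + s ^+ 2 = 1).
    by rewrite !expr_div_n -mulrDl -rho2 divff// expf_neq0.
  have cs' : (c ^+ 2 + (- s) ^+ 2 = 1) by rewrite sqrrN.
  pose G := givens j j' c s.
  have GT : G^T = givens j j' c (- s) by exact: tr_givens.
  have GG : G^T *m G = 1%:M.
    by rewrite GT; have := givensV jj' cs'; rewrite opprK.
  rewrite (householder_conj w GG).
  apply: law_invariantM; last exact: (law_invariant_givens gS jj' s0 cs).
  apply: law_invariantM.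
    by rewrite GT; apply: (law_invariant_givens gS jj' _ cs'); rewrite oppr_eq0.
  have Gw a : (G *m w) a 0 = (if a == j then rho else if a == j' then 0
      else w a 0).
    have -> : (G *m w) a 0 = (w^T *m G^T) 0 a by rewrite -trmx_mul [RHS]mxE.
    rewrite GT -rot_colsE !mxE mem_enum/=.
    case: eqP => [_|_].
      apply: (mulIf rho0); rewrite -expr2 rho2 mulrBl -!mulrA.
      by rewrite !(mulrC _ rho) /c /s; field.
    by case: eqP => // _; rewrite /c /s; ring.
  apply: IH; last by rewrite trmx_mul mulmxA -(mulmxA _ G^T) GG mulmx1.
  rewrite ltnS in wN; apply: leq_trans wN; apply/proper_card/properP; split.
    apply/fintype.subsetP => a; rewrite !inE Gw.
    by have [->|_] := eqVneq a j; last have [->|_] := eqVneq a j'.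
  by exists j'; rewrite !inE // Gw (eq_sym j') (negbTE jj') !eqxx.
move=> wj' _.
have w0 a : a != j -> w a 0 = 0.
  move=> aj; apply/eqP/negPn/negP => wa; apply: wj'; exists a.
  by rewrite eq_sym aj.
have wj2 : (w j 0 * w j 0 = 1).
  by rewrite -expr2 -w11 (bigD1 j)//= big1 ?addr0// => a /w0 ->; rewrite expr0n.
suff -> : householder w = flip j by exact: law_invariant_flip gS _.
apply/matrixP => a b; rewrite !mxE big_ord1 !mxE.
have [->|bj] := eqVneq b j; last by rewrite (w0 b)// !mulr0; ring.
have [->|aj] := eqVneq a j; first by rewrite wj2 /=; ring.
by rewrite (w0 a)// !mul0r /=; ring.
Qed.

End HouseholderInvariance.

(** * Almost sure full rank *)

Section AlmostSurelyNonzero.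
Context {d : measure_display} {T : measurableType d} {R : realType}.
Variables (P : probability T R) (k m : nat) (S : T -> 'M[R]_(k, m)).
Hypothesis gS : gaussian_matrix P S.
Notation gauss := (@normal_prob R 0 1).

Lemma gauss_set1 (z : R) : gauss [set z] = 0%E.
Proof. exact: integral_set1. Qed.

Definition mx_rborel k' m' (F : 'M[R]_(k', m') -> R) :=
  mx_borel (fun M => (F M)%:E).

Lemma mx_rborelP k' m' (F : 'M[R]_(k', m') -> R) d' (T' : measurableType d')
    (U : T' -> 'M[R]_(k', m')) :
  mx_rborel F -> mx_measurable U -> measurable_fun setT (fun w => F (U w)).
Proof. by move=> mF mU; apply/measurable_EFinP; exact: mF. Qed.

Let chi (x : R) : \bar R := (\1_[set (0 : R)] x)%:E.

Let chi_ge0 x : (0 <= chi x)%E. Proof. by rewrite lee_fin. Qed.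

Let chi_le1 x : (chi x <= 1)%E.
Proof. by rewrite lee_fin indicE; case: (_ \in _). Qed.

Let chi0 x : x != 0 -> chi x = 0%E.
Proof. by move=> x0; rewrite /chi indicE memNset//= => /eqP; rewrite (negbTE x0). Qed.

Let mchi : measurable_fun setT chi.
Proof. by apply/measurable_EFinP; exact: measurable_indic. Qed.

(** An affine function that is nonzero somewhere has at most one root, and a point has Gaussian
    measure zero. *)
Let affine_root (a b x0 : R) : a + x0 * b != 0 ->
  (\int[gauss]_x chi (a + x * b) = 0)%E.
Proof.
move=> ab0; have [b0|b0] := eqVneq b 0.
  rewrite b0 mulr0 addr0 in ab0.
  rewrite -[RHS](integral0 gauss setT); apply: eq_integral => x _.
  by rewrite b0 mulr0 addr0 chi0.
transitivity (\int[gauss]_x (\1_[set (- a / b)] x)%:E)%E.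
  apply: eq_integral => x _; rewrite /chi !indicE; congr ((nat_of_bool _)%:R%:E).
  apply/idP/idP; rewrite !inE/= => H.
    by rewrite (_ : a = - (x * b)) ?opprK ?mulfK//; lra.
  by rewrite H; field.
by rewrite integral_indic// setIT; exact: gauss_set1.
Qed.

(** A function affine in each entry separately and nonzero at one matrix is almost surely nonzero at
    [S]: pass from [M0] to [S] one entry at a time, never increasing the probability of a zero. *)
Lemma affine_ae_neq0 (F : 'M[R]_(k, m) -> R) (M0 : 'M[R]_(k, m)) :
  mx_rborel F ->
  (forall M i j, exists a b, forall x, F (upd M i j x) = a + x * b) ->
  F M0 != 0 -> (\int[P]_w (\1_[set (0 : R)] (F (S w)))%:E = 0)%E.
Proof.
move=> mF aF F0.
(* [mix r M] takes the entries listed in [r] from [M] and the others from [M0], so it goes from [M0]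
   to [M] as [r] grows. *)
pose mix (r : seq ('I_k * 'I_m)) (M : 'M[R]_(k, m)) : 'M[R]_(k, m) :=
  \matrix_(i, j) if (i, j) \in r then M i j else M0 i j.
have bmix r : mx_borel (fun M => chi (F (mix r M))).
  move=> d' T' U mU; apply: (measurableT_comp mchi); apply: mx_rborelP => //.
  move=> i j; under eq_fun do rewrite mxE.
  by case: ((i, j) \in r); [exact: mU|exact: measurable_cst].
have mg d' (T' : measurableType d') (U : T' -> 'M[R]_(k, m)) (r : seq _) :
    mx_measurable U -> measurable_fun setT (fun w => chi (F (mix r (U w)))).
  exact: bmix.
suff H r : (\int[P]_w chi (F (mix r (S w))) = 0)%E.
  rewrite -(H (enum {: 'I_k * 'I_m})); apply: eq_integral => w _.
  congr (chi (F _)); apply/matrixP => i j.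
  by rewrite mxE mem_enum.
elim: r => [|[i j] r IH].
  rewrite -[RHS](integral0 P setT); apply: eq_integral => w _; apply: chi0.
  rewrite [mix _ _](_ : _ = M0)//.
  by apply/matrixP => i j; rewrite mxE.
rewrite (resample1 gS i j (bmix ((i, j) :: r)) (fun=> chi_ge0 _)).
apply/eqP; rewrite eq_le; apply/andP; split; last first.
  by apply: integral_ge0 => w _; apply: integral_ge0 => x _; exact: chi_ge0.
rewrite -IH; apply: ge0_le_integral => //.
- by move=> w _; apply: integral_ge0 => x _; exact: chi_ge0.
- apply: (resample_borel i j (bmix ((i, j) :: r)) (fun=> chi_ge0 _)).
  exact: (gaussian_mx_measurable gS).
- by apply: mg; exact: (gaussian_mx_measurable gS).
move=> w _.
have E x : mix ((i, j) :: r) (upd (S w) i j x) = upd (mix r (S w)) i j x.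
  apply/matrixP => a b; rewrite !mxE inE xpair_eqE.
  by case: (_ && _).
under eq_integral do rewrite E.
have [a [b ab]] := aF (mix r (S w)) i j.
under eq_integral do rewrite ab.
(* If [F] already vanishes, the bound is the trivial one by 1. Otherwise the affine function of the
   resampled entry is nonzero at the current value of that entry, and the inner integral is 0. *)
have [F1|F1] := eqVneq (F (mix r (S w))) 0.
  rewrite F1; have -> : chi 0 = 1%E by rewrite /chi indicE mem_set.
  rewrite -(@probability_setT _ _ _ gauss) -[leRHS]mul1e.
  rewrite -(@integral_cst _ _ _ gauss setT measurableT 1%E).
  apply: ge0_le_integral => //.
  apply: (measurableT_comp mchi); apply: measurable_funD => //.
  exact: measurable_funM.
rewrite (affine_root (x0 := mix r (S w) i j))//.
by rewrite -ab upd_id.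
Qed.

End AlmostSurelyNonzero.

(** * Projections onto row spaces *)

Section SquaredNorm.
Context {R : realType}.

Definition dot n (u v : 'cV[R]_n) : R := (u^T *m v) 0 0.

Definition sqn n (v : 'cV[R]_n) : R := dot v v.

Lemma sqnE n (v : 'cV[R]_n) : sqn v = \sum_i v i 0 ^+ 2.
Proof. by rewrite /sqn /dot mxE; apply: eq_bigr => i _; rewrite mxE expr2. Qed.

Lemma sqn_ge0 n (v : 'cV[R]_n) : 0 <= sqn v.
Proof. by rewrite sqnE sumr_ge0// => i _; rewrite sqr_ge0. Qed.

Lemma sqn_eq0 n (v : 'cV[R]_n) : (sqn v == 0) = (v == 0).
Proof.
apply/eqP/eqP => [|->]; last by rewrite /sqn /dot mulmx0 mxE.
rewrite sqnE => /eqP; rewrite psumr_eq0 => [/allP v0|i _]; last exact: sqr_ge0.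
apply/colP => i; rewrite mxE; apply/eqP; rewrite -sqrf_eq0.
exact: v0 i (mem_index_enum i).
Qed.

Lemma norm2_sqr n (v : 'cV[R]_n) : norm2 v ^+ 2 = sqn v.
Proof. by rewrite /norm2 -sqnE sqr_sqrtr ?sqn_ge0. Qed.

Lemma dotC n (u v : 'cV[R]_n) : dot u v = dot v u.
Proof. by rewrite /dot -[u^T *m v]trmxK trmx_mul trmxK mxE. Qed.

Lemma dotDr n (u v w : 'cV[R]_n) : dot u (v + w) = dot u v + dot u w.
Proof. by rewrite /dot mulmxDr mxE. Qed.

Lemma dotNr n (u v : 'cV[R]_n) : dot u (- v) = - dot u v.
Proof. by rewrite /dot mulmxN mxE. Qed.

Lemma dotZr n (u v : 'cV[R]_n) a : dot u (a *: v) = a * dot u v.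
Proof. by rewrite /dot -scalemxAr mxE. Qed.

Lemma dotDl n (u v w : 'cV[R]_n) : dot (v + w) u = dot v u + dot w u.
Proof. by rewrite !(dotC _ u) dotDr. Qed.

Lemma dotNl n (u v : 'cV[R]_n) : dot (- v) u = - dot v u.
Proof. by rewrite !(dotC _ u) dotNr. Qed.

Lemma dotZl n (u v : 'cV[R]_n) a : dot (a *: v) u = a * dot v u.
Proof. by rewrite !(dotC _ u) dotZr. Qed.

Lemma dot_mulmx m n (M : 'M[R]_(m, n)) u v : dot u (M *m v) = dot (M^T *m u) v.
Proof. by rewrite /dot trmx_mul trmxK mulmxA. Qed.

Lemma sqnB n (u v : 'cV[R]_n) : sqn (u - v) = sqn u - 2 * dot u v + sqn v.
Proof.
rewrite /sqn dotDr !dotDl dotNr !dotNl dotNr (dotC v u); ring.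
Qed.

End SquaredNorm.

Section RowProjection.
Context {R : realType} {k n : nat}.
Implicit Types (B : 'M[R]_(k, n)) (v : 'cV[R]_n).

Definition rproj B : 'M[R]_n := mpinv B *m B.

Definition qproj B v : R := dot v (rproj B *m v).

Lemma rproj_tr B : (rproj B)^T = rproj B.
Proof. by have [] := mpinvP B. Qed.

Lemma rproj_idem B : rproj B *m rproj B = rproj B.
Proof. by rewrite /rproj mulmxA; have [_ -> _ _] := mpinvP B. Qed.

Lemma mulmx_rproj B : B *m rproj B = B.
Proof. by rewrite /rproj mulmxA; have [-> _ _ _] := mpinvP B. Qed.

Lemma qprojE B v : qproj B v = sqn (rproj B *m v).
Proof.
by rewrite /qproj /sqn -{1}rproj_idem -mulmxA dot_mulmx rproj_tr.
Qed.

Lemma qproj_ge0 B v : 0 <= qproj B v.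
Proof. by rewrite qprojE sqn_ge0. Qed.

Lemma sqn_subproj B v : sqn (v - rproj B *m v) = sqn v - qproj B v.
Proof. by rewrite sqnB -qprojE -/(qproj B v); ring. Qed.

Lemma qproj_le B v : qproj B v <= sqn v.
Proof. by rewrite -subr_ge0 -sqn_subproj sqn_ge0. Qed.

(* The distance from [P v] to a point [B^T y] of the row space is nonnegative. *)
Lemma qproj_ge B v y : 2 * dot y (B *m v) - sqn (B^T *m y) <= qproj B v.
Proof.
rewrite -subr_ge0.
have -> : qproj B v - (2 * dot y (B *m v) - sqn (B^T *m y)) =
    sqn (rproj B *m v - B^T *m y).
  rewrite sqnB -qprojE (dotC (rproj B *m v)) -dot_mulmx mulmxA mulmx_rproj.
  by ring.
exact: sqn_ge0.
Qed.

(** Equality case of [qproj_ge]: the transposed pseudoinverse supplies coefficients whose row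
    combination is exactly the projection of [v]. *)
Lemma qproj_attained B v :
  qproj B v = 2 * dot ((mpinv B)^T *m v) (B *m v) - sqn (B^T *m ((mpinv B)^T *m v)).
Proof.
have -> : B^T *m ((mpinv B)^T *m v) = rproj B *m v.
  by rewrite mulmxA -trmx_mul rproj_tr.
rewrite -qprojE dot_mulmx !mulmxA -trmx_mul -/(rproj B) rproj_tr dotC.
by rewrite -/(qproj B v); ring.
Qed.

Lemma rproj_trace B : row_free B -> \tr (rproj B) = k%:R.
Proof.
move=> fB; rewrite /rproj mxtrace_mulC.
have -> : B *m mpinv B = 1%:M.
  by apply: (row_free_inj fB); rewrite mul1mx; have [] := mpinvP B.
by rewrite mxtrace1.
Qed.

Lemma qproj_parallelogram B u v :
  qproj B (u + v) + qproj B (u - v) = 2 * qproj B u + 2 * qproj B v.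
Proof.
rewrite /qproj !mulmxDr mulmxN !dotDr !dotDl !dotNr !dotNl.
by ring.
Qed.

Lemma qprojZ B a v : qproj B (a *: v) = a ^+ 2 * qproj B v.
Proof. by rewrite /qproj -scalemxAr dotZr dotZl mulrA expr2. Qed.

(** Tikhonov regularization. Being invertible for [e > 0], it makes [qridge B e v] a measurable
    function of [B] through determinants and cofactors; [qridge B e v] tends to [qproj B v] as [e]
    decreases to 0. *)
Definition ridge B (e : R) : 'M[R]_k := B *m B^T + e%:M.

Definition qridge B e v : R := dot (B *m v) (invmx (ridge B e) *m (B *m v)).

Lemma ridge_tr B e : (ridge B e)^T = ridge B e.
Proof. by rewrite /ridge raddfD /= trmx_mul trmxK tr_scalar_mx. Qed.

Lemma ridge_form B e z : dot z (ridge B e *m z) = sqn (B^T *m z) + e * sqn z.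
Proof.
by rewrite /ridge mulmxDl dotDr -mulmxA dot_mulmx mul_scalar_mx dotZr.
Qed.

Lemma ridge_unit B e : 0 < e -> ridge B e \in unitmx.
Proof.
move=> e0; rewrite -row_free_unit -kermx_eq0; apply/eqP/row_matrixP => i.
rewrite row0; set u := row i _.
have uK : u *m ridge B e = 0 by apply/sub_kermxP; exact: row_sub.
have : dot u^T (ridge B e *m u^T) = 0.
  by rewrite -(ridge_tr B e) -trmx_mul uK trmx0 /dot mulmx0 mxE.
rewrite ridge_form => /eqP.
rewrite paddr_eq0 ?mulr_ge0 ?sqn_ge0 ?(ltW e0)//.
rewrite (mulf_eq0 e) (gt_eqF e0) (sqn_eq0 u^T).
by case/andP => _ /eqP u0; rewrite -[u]trmxK u0 trmx0.
Qed.

Lemma qridge_le B e v : 0 < e -> qridge B e v <= qproj B v.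
Proof.
move=> e0; pose y := invmx (ridge B e) *m (B *m v).
have Ky : ridge B e *m y = B *m v by rewrite mulmxA mulmxV ?mul1mx// ridge_unit.
have yE : qridge B e v = dot y (B *m v) by rewrite dotC.
have := ridge_form B e y; rewrite Ky -yE => qE.
have := qproj_ge B v y; rewrite -yE.
by have := mulr_ge0 (ltW e0) (sqn_ge0 y); lra.
Qed.

(** [qridge B e v] is the maximum over z of 2 <z, B v> - |B^T z|^2 - e |z|^2. Taking for z the
    maximizer of the unpenalized problem, as in [qproj_attained], loses only its penalty. *)
Lemma qridge_ge B e v : 0 < e ->
  qproj B v - e * sqn ((mpinv B)^T *m v) <= qridge B e v.
Proof.
move=> e0; pose y := invmx (ridge B e) *m (B *m v).
pose z := (mpinv B)^T *m v.
have Ky : ridge B e *m y = B *m v by rewrite mulmxA mulmxV ?mul1mx// ridge_unit.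
have yE : qridge B e v = dot y (B *m v) by rewrite dotC.
have : 0 <= dot (y - z) (ridge B e *m (y - z)).
  by rewrite ridge_form addr_ge0 ?sqn_ge0// mulr_ge0 ?sqn_ge0// ltW.
have -> : dot (y - z) (ridge B e *m (y - z)) =
    dot y (B *m v) - 2 * dot z (B *m v) + dot z (ridge B e *m z).
  rewrite mulmxDr mulmxN Ky !dotDr !dotNr !dotDl !dotNl.
  by rewrite [dot y (ridge B e *m z)]dot_mulmx ridge_tr Ky (dotC _ z); ring.
rewrite -yE ridge_form.
by have := qproj_attained B v; rewrite -/z; lra.
Qed.

End RowProjection.

(** * Measurability of the projection *)

Section ProjectionMeasurability.
Context {R : realType} {d : measure_display} {T : measurableType d}.

Lemma measurable_inv : measurable_fun setT (@GRing.inv R).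
Proof.
have -> : setT = [set~ (0 : R)] `|` [set 0] by rewrite setvU.
apply/measurable_funU.
- exact: measurableC.
- exact: measurable_set1.
split; last exact: measurable_fun_set1.
apply: open_continuous_measurable_fun.
  by apply/closed_openC; exact: closed_eq.
by move=> x; rewrite inE/= => /eqP x0; exact: inv_continuous.
Qed.

Lemma measurable_det n (U : T -> 'M[R]_n) :
  mx_measurable U -> measurable_fun setT (fun w => \det (U w)).
Proof.
move=> mU; apply: measurable_sum => s; apply: measurable_funM => //.
by apply: measurable_prod => i _; exact: mU.
Qed.

Lemma mx_measurable_invmx n (U : T -> 'M[R]_n) : (forall w, U w \in unitmx) ->
  mx_measurable U -> mx_measurable (fun w => invmx (U w)).
Proof.
move=> uU mU i j; under eq_fun do rewrite /invmx uU mxE.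
apply: measurable_funM.
  by apply: (measurableT_comp measurable_inv); exact: measurable_det.
under eq_fun do rewrite mxE; apply: measurable_funM => //.
by apply: measurable_det => a b; under eq_fun do rewrite !mxE; exact: mU.
Qed.

Lemma mx_measurable_tr k n (U : T -> 'M[R]_(k, n)) :
  mx_measurable U -> mx_measurable (fun w => (U w)^T).
Proof. by move=> mU i j; under eq_fun do rewrite mxE; exact: mU. Qed.

Lemma mx_measurable_add k n (U V : T -> 'M[R]_(k, n)) :
  mx_measurable U -> mx_measurable V -> mx_measurable (fun w => U w + V w).
Proof.
by move=> mU mV i j; under eq_fun do rewrite mxE; exact: measurable_funD.
Qed.

Lemma mx_measurable_opp k n (U : T -> 'M[R]_(k, n)) :
  mx_measurable U -> mx_measurable (fun w => - U w).
Proof.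
by move=> mU i j; under eq_fun do rewrite mxE; exact: measurable_funN.
Qed.

Lemma measurable_dot n (U V : T -> 'cV[R]_n) :
  mx_measurable U -> mx_measurable V -> measurable_fun setT (fun w => dot (U w) (V w)).
Proof.
by move=> mU mV; apply: mx_measurable_mul => //; exact: mx_measurable_tr.
Qed.

Lemma measurable_qproj k n (B : T -> 'M[R]_(k, n)) (v : T -> 'cV[R]_n) :
  mx_measurable B -> mx_measurable v ->
  measurable_fun setT (fun w => qproj (B w) (v w)).
Proof.
move=> mB mv; have h0 i : 0 < harmonic i :> R by exact: harmonic_gt0.
apply: (@measurable_fun_cvg _ _ _ _
    (fun i w => qridge (B w) (harmonic i) (v w))) => [i|w _].
  have mBv : mx_measurable (fun w => B w *m v w) by exact: mx_measurable_mul.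
  apply: measurable_dot => //; apply: mx_measurable_mul => //.
  apply: mx_measurable_invmx => [w|]; first exact: ridge_unit.
  apply: mx_measurable_add; last exact: mx_measurable_cst.
  by apply: mx_measurable_mul => //; exact: mx_measurable_tr.
apply: (@squeeze_cvgr _ _ _ _
    (fun i => qproj (B w) (v w) - harmonic i * sqn ((mpinv (B w))^T *m v w))
    (fun=> qproj (B w) (v w))).
- by near=> i; rewrite qridge_le// qridge_ge.
- rewrite -[X in _ --> X]subr0 -[X in _ - X](mul0r (sqn ((mpinv (B w))^T *m v w))).
  apply: cvgB; first exact: cvg_cst.
  by apply: cvgMr_tmp; exact: cvg_harmonic.
- exact: cvg_cst.
Unshelve. all: by end_near.
Qed.

Lemma mx_measurable_rproj k n (B : T -> 'M[R]_(k, n)) :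
  mx_measurable B -> mx_measurable (fun w => rproj (B w)).
Proof.
move=> mB i j.
pose e (a : 'I_n) : 'cV[R]_n := delta_mx a 0.
have eE M (a b : 'I_n) : dot (e a) (M *m e b) = M a b.
  by rewrite /dot /e trmx_delta -rowE -colE !mxE.
(* Polarization: the entries of a symmetric matrix are recovered from its quadratic form. *)
have -> : (fun w => rproj (B w) i j) = (fun w =>
    2^-1 * (qproj (B w) (e i + e j) - qproj (B w) (e i) - qproj (B w) (e j))).
  apply/funext => w; rewrite /qproj !mulmxDr !dotDr !dotDl !eE.
  have -> : rproj (B w) j i = rproj (B w) i j by rewrite -{1}rproj_tr mxE.
  by field.
by apply: measurable_funM => //; apply: measurable_funB; [apply: measurable_funB|];
  apply: measurable_qproj => //; exact: mx_measurable_cst.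
Qed.

End ProjectionMeasurability.

(** * Spectral theorem and sketch symmetries *)

Section Spectral.
Context {R : realType}.

Lemma char_poly_conj_invol n (H W : 'M[R]_n) : H *m H = 1%:M ->
  char_poly (H *m W *m H) = char_poly W.
Proof.
move=> HH; pose Hp := map_mx (@polyC R) H.
have HpHp : Hp *m Hp = 1%:M by rewrite -map_mxM HH map_mx1.
rewrite /char_poly.
have -> : char_poly_mx (H *m W *m H) = Hp *m char_poly_mx W *m Hp.
  rewrite /char_poly_mx mulmxBr mulmxBl !map_mxM; congr (_ - _).
  by rewrite -mulmxA mul_scalar_mx -scalemxAr HpHp scalemx1.
by rewrite !det_mulmx mulrC mulrA -det_mulmx HpHp det1 mul1r.
Qed.

Lemma char_poly_block_diag n (a : 'M[R]_1) (W : 'M[R]_n) :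
  char_poly (block_mx a 0 0 W : 'M[R]_(1 + n)) =
    ('X - (a 0 0)%:P) * char_poly W.
Proof.
rewrite /char_poly /char_poly_mx map_block_mx !map_mx0 (scalar_mx_block 1 n).
rewrite opp_block_mx add_block_mx !oppr0 !addr0 det_ublock; congr (_ * _).
by rewrite det_mx11 !mxE eqxx.
Qed.

(* For u = e the coefficient is 2 / 0 = 0 and the matrix is the identity. *)
Lemma unit_vectors_reflection n (u e : 'cV[R]_n) : sqn u = 1 -> sqn e = 1 ->
  exists H : 'M[R]_n, [/\ H^T = H, H *m H = 1%:M & H *m e = u].
Proof.
move=> u1 e1; have [x xE] : exists x, x = u - e by exists (u - e).
pose c := 2 / sqn x.
have xx : x^T *m x = (sqn x)%:M by rewrite [LHS]mx11_scalar.
have xe : x^T *m e = (dot u e - 1)%:M.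
  by rewrite [LHS]mx11_scalar -/(dot x e) xE dotDl dotNl -/(sqn e) e1.
have s2 : sqn x = 2 - 2 * dot u e by rewrite xE sqnB u1 e1; ring.
pose H : 'M[R]_n := 1%:M - c *: (x *m x^T).
have x0 : sqn x = 0 -> x = 0 by move=> /eqP; rewrite sqn_eq0 => /eqP.
exists H; split.
- by rewrite /H raddfB /= trmx1 linearZ /= trmx_mul trmxK.
- have -> : H *m H = 1%:M + (c ^+ 2 * sqn x - 2 * c) *: (x *m x^T).
    have XX : x *m x^T *m (x *m x^T) = sqn x *: (x *m x^T).
      by rewrite mulmxA -(mulmxA x) xx mul_mx_scalar -scalemxAl.
    rewrite /H mulmxBr mulmx1 mulmxBl mul1mx -scalemxAl -scalemxAr XX.
    by apply/matrixP => a b; rewrite !mxE; ring.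
  have [s0|s0] := eqVneq (sqn x) 0.
    by rewrite (x0 s0) mul0mx scaler0 addr0.
  have -> : c ^+ 2 * sqn x - 2 * c = 0 by rewrite /c; field.
  by rewrite scale0r addr0.
- rewrite /H mulmxBl mul1mx -scalemxAl -mulmxA xe.
  rewrite mul_mx_scalar scalerA.
  have [s0|s0] := eqVneq (sqn x) 0.
    rewrite (x0 s0) scaler0 subr0; apply/eqP; rewrite eq_sym -subr_eq0.
    by rewrite -xE x0.
  have -> : c * (dot u e - 1) = - 1.
    by rewrite /c (_ : dot u e - 1 = - (sqn x / 2)) ?s2; [field; rewrite -s2|field].
  by rewrite scaleN1r opprK xE addrC subrK.
Qed.

(** Deflation: a reflection sending the first basis vector to a unit eigenvector for the head of [l]
    splits off a block of size 1, and the tail of [l] factors the remaining characteristic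
    polynomial. Real eigenvalues come from the assumed factorization, and the eigenvectors follow
    the order of [l], which later aligns them with the sorted singular values. *)
Lemma sym_spectral n (W : 'M[R]_n) (l : seq R) :
  W^T = W -> char_poly W = \prod_(x <- l) ('X - x%:P) ->
  exists V : 'M[R]_n, V^T *m V = 1%:M /\ W *m V = V *m diag_mx (\row_i l`_i).
Proof.
elim: n W l => [|n IH] W l Wsym cW.
  by exists 1%:M; split; apply/matrixP => -[].
case: l cW => [|x l] cW.
  by move/(congr1 (size \o val)): cW; rewrite /= size_char_poly big_nil size_poly1.
have : eigenvalue W x.
  by rewrite eigenvalue_root_char cW root_prod_XsubC mem_head.
case/eigenvalueP => v vW v0.
have sv : 0 < sqn v^T.
  rewrite lt_neqAle sqn_ge0 andbT eq_sym sqn_eq0.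
  by apply: contra v0 => /eqP v0; rewrite -[v]trmxK v0 trmx0.
pose u : 'cV[R]_n.+1 := (Num.sqrt (sqn v^T))^-1 *: v^T.
have u1 : sqn u = 1.
  rewrite /u /sqn dotZl dotZr mulrA -expr2 exprVn sqr_sqrtr ?ltW// mulVf//.
  by rewrite gt_eqF.
have Wu : W *m u = x *: u.
  rewrite /u -scalemxAr -[in LHS]Wsym -trmx_mul vW linearZ /= !scalerA.
  by rewrite mulrC.
pose e : 'cV[R]_(1 + n) := col_mx 1%:M 0.
have e1 : sqn e = 1.
  by rewrite /sqn /dot tr_col_mx mul_row_col trmx1 mul1mx trmx0 mul0mx addr0 mxE.
have [H [Hsym HH He]] := unit_vectors_reflection u1 e1.
pose W' : 'M[R]_(1 + n) := H *m W *m H.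
have W'sym : W'^T = W' by rewrite /W' !trmx_mul Hsym Wsym mulmxA.
have W'e : W' *m e = x *: e.
  by rewrite /W' -!mulmxA He Wu -scalemxAr -He mulmxA HH mul1mx.
have W'E : W' = block_mx x%:M 0 0 (drsubmx W').
  rewrite -[LHS]submxK.
  have : W' *m e = col_mx (ulsubmx W') (dlsubmx W').
    by rewrite -[in LHS](submxK W') mul_block_col !mulmx0 !addr0 !mulmx1.
  rewrite W'e scale_col_mx scaler0 scalemx1 => /eq_col_mx[ulE dlE].
  congr block_mx => //; apply: trmx_inj.
  by rewrite trmx0 trmx_ursub W'sym.
set W1 := drsubmx W' in W'E.
have cW1 : char_poly W1 = \prod_(y <- l) ('X - y%:P).
  have : ('X - x%:P) * char_poly W1 = ('X - x%:P) * \prod_(y <- l) ('X - y%:P).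
    rewrite -[RHS](big_cons _ _ x l xpredT (fun y => 'X - y%:P)) -cW.
    rewrite -(char_poly_conj_invol W HH) -/W' W'E char_poly_block_diag.
    by rewrite mxE eqxx.
  by apply/mulfI; rewrite polyXsubC_eq0.
have W1sym : W1^T = W1 by rewrite /W1 trmx_drsub W'sym.
have [V1 [V1V1 W1V1]] := IH W1 l W1sym cW1.
pose V2 : 'M[R]_(1 + n) := block_mx 1%:M 0 0 V1.
have V2V2 : V2^T *m V2 = 1%:M.
  rewrite /V2 tr_block_mx mulmx_block !trmx0 trmx1 !mulmx0 !mul0mx !addr0 !add0r.
  by rewrite mulmx1 V1V1 -scalar_mx_block.
exists (H *m V2); split.
  by rewrite trmx_mul Hsym mulmxA -(mulmxA V2^T) HH mulmx1.
have -> : W *m (H *m V2) = H *m (W' *m V2).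
  by rewrite /W' !mulmxA HH mul1mx.
rewrite -[RHS]mulmxA; congr (mulmx H _).
have lE : \row_i (x :: l)`_i = row_mx x%:M (\row_i l`_i) :> 'rV[R]_(1 + n).
  apply/rowP => i; rewrite [LHS]mxE; case: (split_ordP i) => j ->.
    by rewrite row_mxEl ord1 mxE eqxx.
  by rewrite row_mxEr mxE.
have -> : diag_mx (\row_i (x :: l)`_i) =
    block_mx (diag_mx x%:M) 0 0 (diag_mx (\row_i l`_i)) :> 'M[R]_(1 + n).
  by rewrite lE; exact: diag_mx_row.
rewrite W'E /V2; etransitivity; first exact: (@mulmx_block _ 1 n 1 n 1 n).
apply/esym; etransitivity; first exact: (@mulmx_block _ 1 n 1 n 1 n).
rewrite !mulmx0 !mul0mx !mulmx1 !mul1mx !addr0 !add0r W1V1.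
have -> // : diag_mx x%:M = x%:M :> 'M[R]_1.
by apply/matrixP => i j; rewrite !ord1 !mxE eqxx.
Qed.

End Spectral.

Section Reflections.
Context {R : realType}.

Lemma householder_mul n (w x : 'cV[R]_n) :
  householder w *m x = x - (2 * dot w x) *: w.
Proof.
rewrite /householder mulmxBl mul1mx -scalemxAl -mulmxA.
by rewrite [w^T *m x]mx11_scalar -/(dot w x) mul_mx_scalar scalerA.
Qed.

Lemma householder_invol n (w : 'cV[R]_n) : sqn w = 1 ->
  householder w *m householder w = 1%:M.
Proof.
move=> w1; have ww : w^T *m w = 1%:M by rewrite [LHS]mx11_scalar -/(dot w w) [dot _ _]w1.
have wwww : w *m w^T *m (w *m w^T) = w *m w^T.
  by rewrite mulmxA -(mulmxA w) ww mulmx1.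
rewrite /householder mulmxBr mulmx1 mulmxBl mul1mx -scalemxAl -scalemxAr wwww.
by apply/matrixP => a b; rewrite !mxE; ring.
Qed.

(** For a symmetric orthogonal [H], the matrix [H *m mpinv B] satisfies the Penrose equations of
    [B *m H], so the projection is conjugated by [H]. *)
Lemma qproj_mulr k n (B : 'M[R]_(k, n)) (H : 'M[R]_n) v :
  H^T = H -> H *m H = 1%:M -> qproj (B *m H) v = qproj B (H *m v).
Proof.
move=> Hsym HH; have [e1 e2 e3 e4] := mpinvP B.
have HHM p (M : 'M[R]_(n, p)) : H *m (H *m M) = M by rewrite mulmxA HH mul1mx.
have E : mpinv (B *m H) = H *m mpinv B.
  apply: (penrose_uniq (mpinvP _)); split.
  - by rewrite -!mulmxA HHM !mulmxA e1.
  - by rewrite -!mulmxA HHM !mulmxA -(mulmxA H) -(mulmxA H) e2.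
  - by rewrite -!mulmxA HHM e3.
  - have -> : H *m mpinv B *m (B *m H) = H *m (mpinv B *m B) *m H.
      by rewrite !mulmxA.
    by rewrite trmx_mul [(H *m _)^T]trmx_mul e4 Hsym mulmxA.
by rewrite /qproj /rproj E -!mulmxA dot_mulmx Hsym.
Qed.

End Reflections.

Section SketchSymmetries.
Context {R : realType} {m n : nat} (A : 'M[R]_(m, n)).

(** [u] is the left singular vector paired with [v], so A^T u is a multiple of v and A v a multiple
    of u; reflecting along [u] on the left of [A] is then reflecting along [v] on its right. *)
Lemma flip_sketch k (S : 'M[R]_(k, m)) v (l : R) : 0 < l -> sqn v = 1 ->
  A^T *m A *m v = l *: v ->
  let u := (Num.sqrt l)^-1 *: (A *m v) in
  sqn u = 1 /\ S *m householder u *m A = S *m A *m householder v.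
Proof.
move=> l0 v1 Av u.
have s2 : Num.sqrt l * Num.sqrt l = l by rewrite -expr2 sqr_sqrtr// ltW.
have s0 : Num.sqrt l != 0 by rewrite gt_eqF// sqrtr_gt0.
have uTA : u^T *m A = Num.sqrt l *: v^T.
  rewrite -[A in LHS]trmxK -trmx_mul /u -scalemxAr mulmxA Av scalerA.
  by rewrite -{2}s2 mulrA mulVf// mul1r linearZ.
have Asq : sqn (A *m v) = l.
  by rewrite /sqn dot_mulmx mulmxA Av dotZl -/(sqn v) v1 mulr1.
split; first by rewrite /u /sqn dotZl dotZr -/(sqn _) Asq -{3}s2; field.
rewrite -!mulmxA; congr (S *m _).
rewrite /householder mulmxBl mulmxBr mul1mx mulmx1 -scalemxAl -scalemxAr.
congr (_ - _ *: _); rewrite -mulmxA uTA /u -scalemxAl -scalemxAr scalerA.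
by rewrite mulVf// scale1r mulmxA.
Qed.

(* The reflection exchanging the left singular vectors of v1 and v2; the
   inequality is [S H A A^T H S^T <= K *: S A A^T S^T] tested on the maximizer
   of the variational formula for [qproj (S *m A) v2]. *)
Lemma swap_sketch k (S : 'M[R]_(k, m)) v1 v2 (l1 l2 K : R) :
  0 < l1 -> 0 < l2 -> sqn v1 = 1 -> sqn v2 = 1 -> dot v1 v2 = 0 ->
  A^T *m A *m v1 = l1 *: v1 -> A^T *m A *m v2 = l2 *: v2 ->
  1 <= K -> l1 <= K * l2 -> l2 <= K * l1 ->
  let w := (Num.sqrt 2)^-1 *:
    ((Num.sqrt l1)^-1 *: (A *m v1) - (Num.sqrt l2)^-1 *: (A *m v2)) in
  sqn w = 1 /\
  l1 / (K * l2) * qproj (S *m A) v2 <= qproj (S *m householder w *m A) v1.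
Proof.
move=> l10 l20 v11 v21 v12 Av1 Av2 K1 l1K l2K w.
pose s1 := Num.sqrt l1; pose s2 := Num.sqrt l2.
have s1s : s1 * s1 = l1 by rewrite -expr2 sqr_sqrtr// ltW.
have s2s : s2 * s2 = l2 by rewrite -expr2 sqr_sqrtr// ltW.
have s10 : s1 != 0 by rewrite gt_eqF// sqrtr_gt0.
have s20 : s2 != 0 by rewrite gt_eqF// sqrtr_gt0.
have K0 : K != 0 by rewrite gt_eqF// (lt_le_trans ltr01).
have [u1 u1E] : exists u, u = s1^-1 *: (A *m v1) by eexists.
have [u2 u2E] : exists u, u = s2^-1 *: (A *m v2) by eexists.
have Atu1 : A^T *m u1 = s1 *: v1.
  by rewrite u1E -scalemxAr mulmxA Av1 scalerA -s1s mulKf.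
have Atu2 : A^T *m u2 = s2 *: v2.
  by rewrite u2E -scalemxAr mulmxA Av2 scalerA -s2s mulKf.
have Au1 : A *m v1 = s1 *: u1 by rewrite u1E scalerA divff// scale1r.
have Au2 : A *m v2 = s2 *: u2 by rewrite u2E scalerA divff// scale1r.
have u11 : sqn u1 = 1.
  rewrite /sqn {1}u1E dotZl dotC dot_mulmx Atu1 dotZl -/(sqn v1) v11.
  by rewrite mulr1 mulVf.
have u21 : sqn u2 = 1.
  rewrite /sqn {1}u2E dotZl dotC dot_mulmx Atu2 dotZl -/(sqn v2) v21.
  by rewrite mulr1 mulVf.
have u12 : dot u1 u2 = 0.
  by rewrite {1}u1E dotZl dotC dot_mulmx Atu2 dotZl (dotC v2) v12 !mulr0.
have [e eE] : exists e, e = u1 - u2 by eexists.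
have e2 : sqn e = 2 by rewrite eE sqnB u11 u21 u12; ring.
have wE : w = (Num.sqrt 2)^-1 *: e by rewrite eE u1E u2E.
have r2 : (Num.sqrt 2)^-1 * (Num.sqrt 2)^-1 = 2^-1 :> R.
  by rewrite -expr2 exprVn sqr_sqrtr.
split; first by rewrite wE /sqn dotZl dotZr mulrA r2 -/(sqn e) e2 mulVf.
have Hx x : householder w *m x = x - dot e x *: e.
  rewrite householder_mul wE dotZl scalerA; congr (_ - _ *: _).
  transitivity (2 * ((Num.sqrt 2)^-1 * (Num.sqrt 2)^-1) * dot e x); first by ring.
  by rewrite r2; field.
have Hu1 : householder w *m u1 = u2.
  rewrite Hx {1}eE dotDl dotNl -/(sqn u1) u11 (dotC u2) u12 subr0 scale1r eE.
  by rewrite opprB addrC subrK.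
pose z := (mpinv (S *m A))^T *m v2; pose s := S^T *m z.
(* At the maximizer [z] both terms of the variational formula reduce to q = [qproj (S *m A) v2]. For
   the multiple a z the lower bound obtained is (2 a s1 / s2 - K a^2) q, and this [a] is the best
   choice. *)
pose a := s1 / (K * s2).
have := qproj_ge (S *m householder w *m A) v1 (a *: z).
apply: le_trans; rewrite qproj_attained -/z.
have -> : S *m householder w *m A *m v1 = (s1 / s2) *: (S *m A *m v2).
  rewrite -!mulmxA Au1 Au2 -!scalemxAr Hu1 scalerA.
  by rewrite divfK.
have -> : (S *m householder w *m A)^T *m (a *: z) =
    a *: (A^T *m (householder w *m s)).
  by rewrite !trmx_mul householder_tr -scalemxAr -!mulmxA.
have -> : (S *m A)^T *m z = A^T *m s by rewrite trmx_mul -mulmxA.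
rewrite dotZl !dotZr /sqn dotZl dotZr -/(sqn _) -/(sqn _).
have [x xE] : exists x, x = A^T *m s by eexists.
pose a1 := dot u1 s; pose a2 := dot u2 s.
have xv1 : dot x v1 = s1 * a1 by rewrite xE -dot_mulmx Au1 dotZr dotC.
have xv2 : dot x v2 = s2 * a2 by rewrite xE -dot_mulmx Au2 dotZr dotC.
have Bessel : l1 * a1 ^+ 2 + l2 * a2 ^+ 2 <= sqn x.
  have : 0 <= sqn (x - (dot x v1 *: v1 + dot x v2 *: v2)) by exact: sqn_ge0.
  rewrite sqnB dotDr !dotZr {2}/sqn dotDr !dotDl !dotZr !dotZl.
  rewrite -/(sqn v1) -/(sqn v2) v11 v21 (dotC v2) v12 xv1 xv2 -s1s -s2s.
  by move=> H; rewrite -subr_ge0; move: H; congr (0 <= _); ring.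
have AHs : sqn (A^T *m (householder w *m s)) =
    sqn x + (l2 - l1) * (a1 ^+ 2 - a2 ^+ 2).
  rewrite Hx mulmxBr -xE -scalemxAr eE mulmxBr Atu1 Atu2.
  have -> : dot (u1 - u2) s = a1 - a2 by rewrite dotDl dotNl.
  rewrite sqnB dotZr dotDr dotNr !dotZr xv1 xv2.
  rewrite {2}/sqn dotZr dotZl -/(sqn _) sqnB dotZr dotZl v12.
  rewrite /sqn !(dotZl, dotZr) -/(sqn v1) -/(sqn v2) v11 v21 -s1s -s2s.
  by rewrite /sqn; ring.
(* The reflection replaces l1 a1^2 + l2 a2^2 by l2 a1^2 + l1 a2^2, at most [K] times as large. The
   increase is thus at most [K - 1] times a quantity that [Bessel] bounds by [sqn x]. *)
have Kx : sqn (A^T *m (householder w *m s)) <= K * sqn x.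
  rewrite AHs.
  have H : (K - 1) * (l1 * a1 ^+ 2 + l2 * a2 ^+ 2) <= (K - 1) * sqn x.
    by rewrite ler_wpM2l// subr_ge0.
  have H1 : l2 * a1 ^+ 2 <= K * l1 * a1 ^+ 2 by rewrite ler_wpM2r// sqr_ge0.
  have H2 : l1 * a2 ^+ 2 <= K * l2 * a2 ^+ 2 by rewrite ler_wpM2r// sqr_ge0.
  by move: H H1 H2; rewrite !mulrBl !mulrBr !mulrDr !mulrA; lra.
rewrite -xE.
have -> : l1 / (K * l2) * (2 * dot z (S *m A *m v2) - sqn x) =
    2 * (s1 / s2 * (a * dot z (S *m A *m v2))) - a * (a * (K * sqn x)).
  by rewrite /a -s1s -s2s; field; rewrite K0 s20.
have a0 : 0 <= a.
  by rewrite /a divr_ge0 ?mulr_ge0 ?sqrtr_ge0// (le_trans ler01).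
have -> : a * (s1 / s2 * dot z (S *m A *m v2)) =
    s1 / s2 * (a * dot z (S *m A *m v2)) by ring.
by rewrite lerD2l lerN2 ler_wpM2l// ler_wpM2l.
Qed.

End SketchSymmetries.

(** * The mean projection *)

Section FullRank.
Context {d : measure_display} {T : measurableType d} {R : realType}.
Variables (P : probability T R) (k m n : nat) (S : T -> 'M[R]_(k, m)).
Variable (A : 'M[R]_(m, n)).
Hypothesis gS : gaussian_matrix P S.

(** Only row [i] of the product involves [x], affinely, and the determinant is linear in that row.
    In [C] row [i] is the basis vector [j], the coefficient of [x]. *)
Lemma det_affine_entry (B : 'M[R]_(m, k)) (M : 'M[R]_(k, m)) i j :
  exists a b, forall x, \det (upd M i j x *m B) = a + x * b.
Proof.
pose C : 'M[R]_(k, m) := \matrix_(p, q) if p == i then (q == j)%:R else M p q.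
exists (\det (upd M i j 0 *m B)), (\det (C *m B)) => x.
rewrite -[\det (upd M i j 0 *m B)]mul1r.
apply: (@determinant_multilinear _ _ _ _ _ i).
- rewrite !row_mul scale1r scalemxAl -mulmxDl; congr (_ *m _).
  apply/rowP => q; rewrite !mxE eqxx /=.
  by case: eqP => _; rewrite ?mulr1 ?add0r ?mulr0 ?addr0.
- apply/matrixP => p q; rewrite !mxE; apply: eq_bigr => l _; rewrite !mxE.
  by rewrite [lift i p == i]eq_sym (negbTE (neq_lift _ _)).
- apply/matrixP => p q; rewrite !mxE; apply: eq_bigr => l _; rewrite !mxE.
  by rewrite [lift i p == i]eq_sym (negbTE (neq_lift _ _)).
Qed.

(** [F] is the minor of [M *m A] on its first [k] columns. It is not identically zero: a left
    inverse of [A], cut down to [k] rows, gives the identity matrix. Stating the result through [F]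
    expresses full rank by a measurable function. *)
Lemma sketch_row_free_ae : \rank A = n -> (k <= n)%N ->
  exists F : 'M[R]_(k, m) -> R,
    [/\ mx_rborel F, (forall M, F M != 0 -> row_free (M *m A)) &
        (\int[P]_w (\1_[set (0 : R)] (F (S w)))%:E = 0)%E].
Proof.
move=> rA kn; pose E : 'M[R]_(n, k) := pid_mx k.
have mF : mx_rborel (fun M : 'M[R]_(k, m) => \det (M *m (A *m E))).
  move=> d' T' U mU; apply/measurable_EFinP; apply: measurable_det.
  by apply: mx_measurable_mul => //; exact: mx_measurable_cst.
exists (fun M => \det (M *m (A *m E))); split => //.
- move=> M FM; rewrite -row_leq_rank.
  have : \rank (M *m A *m E) = k.
    by apply: mxrank_unit; rewrite unitmxE unitfE -mulmxA.
  by move=> {1}<-; exact: mxrankM_maxl.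
- apply: (affine_ae_neq0 gS (F := fun M => \det (M *m (A *m E)))
    (M0 := E^T *m pinvmx A)) => //.
    by move=> M i j; exact: det_affine_entry.
  have -> : E^T *m pinvmx A *m (A *m E) = E^T *m (pinvmx A *m A) *m E.
    by rewrite !mulmxA.
  rewrite mulVpmx /row_full ?rA// mulmx1 tr_pid_mx mul_pid_mx.
  by rewrite minnn (minn_idPr kn) pid_mx_1 det1 oner_eq0.
Qed.

End FullRank.

Section MeanProjection.
Context {d : measure_display} {T : measurableType d} {R : realType}.
Variables (P : probability T R) (k m n : nat) (S : T -> 'M[R]_(k, m)).
Variable (A : 'M[R]_(m, n)).
Hypothesis gS : gaussian_matrix P S.

(** The quadratic form of Pi; the integral is finite because [qproj] is at most [sqn v]. *)
Definition mean_qproj v : R := fine (\int[P]_w (qproj (S w *m A) v)%:E).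

Lemma qproj_sketch_borel v : mx_borel (fun M : 'M[R]_(k, m) => (qproj (M *m A) v)%:E).
Proof.
move=> d' T' U mU; apply/measurable_EFinP; apply: measurable_qproj.
  by apply: mx_measurable_mul => //; exact: mx_measurable_cst.
exact: mx_measurable_cst.
Qed.

Lemma measurable_qproj_sketch v :
  measurable_fun setT (fun w => (qproj (S w *m A) v)%:E).
Proof. by apply: qproj_sketch_borel; exact: (gaussian_mx_measurable gS). Qed.

Lemma mean_qprojE v :
  (\int[P]_w (qproj (S w *m A) v)%:E)%E = (mean_qproj v)%:E.
Proof.
rewrite /mean_qproj fineK// ge0_fin_numE; last first.
  by apply: integral_ge0 => w _; rewrite lee_fin qproj_ge0.
apply: (@le_lt_trans _ _ (\int[P]_w (cst (sqn v)%:E w))%E).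
  apply: ge0_le_integral => //.
  - by move=> w _; rewrite lee_fin qproj_ge0.
  - exact: measurable_qproj_sketch.
  - by move=> w _; rewrite lee_fin qproj_le.
by rewrite integral_cst//= probability_setT mule1 ltry.
Qed.

Lemma mean_qproj_ge0 v : 0 <= mean_qproj v.
Proof.
by apply/fine_ge0/integral_ge0 => w _; rewrite lee_fin qproj_ge0.
Qed.

Lemma mean_qproj_le v : mean_qproj v <= sqn v.
Proof.
rewrite -lee_fin -mean_qprojE.
have -> : (sqn v)%:E = (\int[P]_w (cst (sqn v)%:E w))%E.
  by rewrite integral_cst//= probability_setT mule1.
apply: ge0_le_integral => //.
- by move=> w _; rewrite lee_fin qproj_ge0.
- exact: measurable_qproj_sketch.
- by move=> w _; rewrite lee_fin qproj_le.
Qed.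

Lemma mean_qprojZ a v : mean_qproj (a *: v) = a ^+ 2 * mean_qproj v.
Proof.
apply: EFin_inj; rewrite -mean_qprojE EFinM -mean_qprojE.
rewrite -ge0_integralZl//.
- by apply: eq_integral => w _; rewrite qprojZ EFinM.
- exact: measurable_qproj_sketch.
- by move=> w _; rewrite lee_fin qproj_ge0.
- by rewrite lee_fin sqr_ge0.
Qed.

Lemma mean_qproj_parallelogram u v :
  mean_qproj (u + v) + mean_qproj (u - v) = 2 * mean_qproj u + 2 * mean_qproj v.
Proof.
apply: EFin_inj; rewrite !EFinD !EFinM -!mean_qprojE.
have q0 B x : (0 <= (qproj B x : R)%:E)%E by rewrite lee_fin qproj_ge0.
rewrite -!ge0_integralZl//; try exact: measurable_qproj_sketch.
rewrite -!ge0_integralD//; try exact: measurable_qproj_sketch.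
- by apply: eq_integral => w _; rewrite -!EFinM -!EFinD qproj_parallelogram.
- by move=> w _; rewrite mule_ge0// lee_fin.
- by apply: measurable_funeM; exact: measurable_qproj_sketch.
- by move=> w _; rewrite mule_ge0// lee_fin.
- by apply: measurable_funeM; exact: measurable_qproj_sketch.
Qed.

Lemma mean_qproj_reflection (w0 : 'cV[R]_m) v : sqn w0 = 1 ->
  (\int[P]_w (qproj (S w *m householder w0 *m A) v)%:E)%E = (mean_qproj v)%:E.
Proof.
move=> w01; have w01' : w0^T *m w0 = 1%:M.
  by rewrite [LHS]mx11_scalar -/(dot w0 w0) -/(sqn w0) w01.
rewrite -mean_qprojE.
have q0 (M : 'M[R]_(k, m)) : (0 <= (qproj (M *m A) v)%:E)%E.
  by rewrite lee_fin qproj_ge0.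
exact: (law_invariant_householder gS w01' (qproj_sketch_borel v) q0).
Qed.

Variables (V : 'M[R]_n) (l : 'I_n -> R).
Hypothesis VV : V^T *m V = 1%:M.
Hypothesis AV : forall i, A^T *m A *m col i V = l i *: col i V.
Hypothesis l_gt0 : forall i, 0 < l i.

Let v i := col i V.

Let dot_v i j : dot (v i) (v j) = (i == j)%:R.
Proof.
move/matrixP/(_ i j): VV; rewrite [RHS]mxE => <-.
by rewrite /dot !mxE; apply: eq_bigr => a _; rewrite !mxE.
Qed.

Let sqn_v i : sqn (v i) = 1. Proof. by rewrite /sqn dot_v eqxx. Qed.

Lemma mean_qproj_flip i x :
  mean_qproj (x - (2 * dot (v i) x) *: v i) = mean_qproj x.
Proof.
apply: EFin_inj; rewrite -mean_qprojE.
have [u1 _] := flip_sketch (0 : 'M[R]_(k, m)) (l_gt0 i) (sqn_v i) (AV i).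
rewrite -(mean_qproj_reflection x u1); apply: eq_integral => w _.
have [_ ->] := flip_sketch (S w) (l_gt0 i) (sqn_v i) (AV i).
rewrite qproj_mulr ?householder_tr ?householder_invol//.
by rewrite householder_mul.
Qed.

Lemma mean_qproj_swap i j c : 1 <= c -> l j <= c * l i ->
  mean_qproj (v j) <= c ^+ 2 * mean_qproj (v i).
Proof.
move=> c1 lji; have c0 : 0 < c by exact: lt_le_trans c1.
have [->|ij] := eqVneq i j.
  rewrite ler_peMl ?mean_qproj_ge0//.
  by rewrite -[leLHS](expr1n _ 2) lerXn2r ?nnegrE ?ler01 ?(ltW c0).
have vij : dot (v i) (v j) = 0 by rewrite dot_v (negbTE ij).
suff [K [K1 Ki Kj Kc]] : exists K, [/\ 1 <= K, l i <= K * l j, l j <= K * l i &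
    K * l j <= c ^+ 2 * l i].
  have H M := swap_sketch M (l_gt0 i) (l_gt0 j) (sqn_v i) (sqn_v j) vij
    (AV i) (AV j) K1 Ki Kj.
  have [w1 _] := H k (0 : 'M[R]_(k, m)).
  have K0 : 0 < K * l j by rewrite mulr_gt0// (lt_le_trans ltr01).
  have le : l i / (K * l j) * mean_qproj (v j) <= mean_qproj (v i).
    rewrite -lee_fin EFinM -mean_qprojE -(mean_qproj_reflection (v i) w1).
    rewrite -ge0_integralZl//.
    - apply: ge0_le_integral => //.
      + by move=> w _; rewrite mule_ge0// lee_fin ?qproj_ge0 ?divr_ge0 ?ltW.
      + by apply: measurable_funeM; exact: measurable_qproj_sketch.
      + apply: (mx_borel_mulr (householder _) (qproj_sketch_borel (v i))).
        exact: (gaussian_mx_measurable gS).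
      + by move=> w _; rewrite -EFinM lee_fin; have [_] := H k (S w).
    - exact: measurable_qproj_sketch.
    - by move=> w _; rewrite lee_fin qproj_ge0.
    - by rewrite lee_fin divr_ge0 ?ltW.
  have : mean_qproj (v j) <= K * l j / l i * mean_qproj (v i).
    rewrite -(ler_pM2l (divr_gt0 (l_gt0 i) K0)); apply: le_trans le _.
    rewrite mulrA [X in X * _](_ : _ = 1) ?mul1r//.
    by field; rewrite !gt_eqF// (lt_le_trans ltr01).
  move/le_trans; apply; rewrite ler_wpM2r ?mean_qproj_ge0//.
  by rewrite ler_pdivrMr.
(* [K] must dominate both ratios of [l i] and [l j]. If [l j <= l i], their ratio may exceed [c],
   but taking it as [K] gives [K * l j = l i]. Otherwise [K = c] suffices, and [l j <= c * l i]
   brings the second factor [c]. *)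
have [lij|lij] := leP (l j) (l i).
  exists (l i / l j); split.
  - by rewrite ler_pdivlMr// mul1r.
  - by rewrite divfK// gt_eqF.
  - by rewrite (le_trans lij)// ler_peMl ?(ltW (l_gt0 i))// ler_pdivlMr// mul1r.
  - rewrite divfK ?gt_eqF// ler_peMl ?(ltW (l_gt0 i))//.
    by rewrite -[leLHS](expr1n _ 2) lerXn2r ?nnegrE ?ler01 ?(ltW c0).
exists c; split => //.
- by rewrite (le_trans (ltW lij))// ler_peMl ?(ltW (l_gt0 j)).
- by rewrite expr2 -mulrA ler_wpM2l// (ltW c0).
Qed.

(** Peel off one term y along [v i]. The flip along [v i] fixes the remaining sum x and negates y,
    so x + y and x - y have equal means and the parallelogram law becomes additivity. *)
Lemma mean_qproj_basis a :
  mean_qproj (V *m a) = \sum_i a i 0 ^+ 2 * mean_qproj (v i).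
Proof.
have -> : V *m a = \sum_(i <- enum 'I_n) a i 0 *: v i.
  apply/colP => b; rewrite big_enum mxE summxE; apply: eq_bigr => i _.
  by rewrite !mxE mulrC.
rewrite -[RHS]big_enum.
have : uniq (enum 'I_n) by exact: enum_uniq.
elim: (enum 'I_n) => [_|i r IH /= /andP[ir ur]].
  rewrite !big_nil; apply/eqP; rewrite eq_le mean_qproj_ge0 andbT.
  by rewrite (le_trans (mean_qproj_le _))// /sqn /dot mulmx0 mxE.
rewrite !big_cons; set y := a i 0 *: v i; set x := \sum_(j <- r) _.
have vx : dot (v i) x = 0.
  rewrite /x; elim: r ir {IH ur x} => [|j r IHr].
    by rewrite big_nil /dot mulmx0 mxE.
  rewrite inE negb_or => /andP[ij ir].
  by rewrite big_cons dotDr dotZr dot_v (negbTE ij) mulr0 add0r IHr.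
have flip_xy : mean_qproj (x - y) = mean_qproj (x + y).
  rewrite -(mean_qproj_flip i (x + y)); congr mean_qproj.
  rewrite dotDr vx add0r /y dotZr dot_v eqxx mulr1.
  by apply/colP => b; rewrite !mxE; ring.
have := mean_qproj_parallelogram x y; rewrite flip_xy -(IH ur) -mean_qprojZ.
rewrite (addrC y x).
by move: (mean_qproj (x + y)) (mean_qproj x) (mean_qproj y) => p q s; lra.
Qed.

Hypotheses (rA : \rank A = n) (kn : (k <= n)%N).

(** The trace equals [k] only where [F] does not vanish. Adding [k] times the indicator of the
    exceptional event, which has mean zero, gives a lower bound valid at every point, which is then
    integrated. *)
Lemma mean_qproj_trace : k%:R <= \sum_i mean_qproj (v i).
Proof.
have [F [mF Ffree F0]] := sketch_row_free_ae gS rA kn.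
have VVT : V *m V^T = 1%:M by exact: mulmx1C.
have tr (B : 'M[R]_(k, n)) : row_free B -> \sum_i qproj B (v i) = k%:R.
  move=> fB; rewrite -(rproj_trace fB) -[rproj B]mulmx1 -VVT mulmxA.
  rewrite mxtrace_mulC; apply: eq_bigr => i _.
  rewrite /qproj /dot !mxE; apply: eq_bigr => j _; rewrite !mxE.
  by congr (_ * _); apply: eq_bigr => a _; rewrite [v i a 0]mxE.
pose chi w := (\1_[set (0 : R)] (F (S w)) : R).
have mchi : measurable_fun setT chi.
  have mFS : measurable_fun setT (fun w => F (S w)).
    by apply: (mx_rborelP mF); exact: (gaussian_mx_measurable gS).
  have m1 : measurable_fun setT (\1_[set (0 : R)] : R -> R).
    exact: measurable_indic.
  exact: (measurableT_comp m1 mFS).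
have mchiE : measurable_fun setT (fun w => (chi w)%:E) by exact/measurable_EFinP.
have chi0 w : (0 <= (chi w)%:E)%E by rewrite lee_fin.
have {}F0 : (\int[P]_w (chi w)%:E = 0)%E by [].
have mkchi : measurable_fun setT (fun w => k%:R%:E * (chi w)%:E)%E.
  exact: measurable_funeM.
have mq i : measurable_fun setT (fun w => (qproj (S w *m A) (v i))%:E).
  exact: measurable_qproj_sketch.
have mS : measurable_fun setT (fun w => \sum_i (qproj (S w *m A) (v i))%:E)%E.
  exact: emeasurable_sum.
have q0 w i : (0 <= (qproj (S w *m A) (v i))%:E)%E by rewrite lee_fin qproj_ge0.
have kE : k%:R%:E = (\int[P]_w (cst k%:R%:E w))%E.
  by rewrite integral_cst//= probability_setT mule1.
rewrite -lee_fin -sumEFin; under eq_bigr do rewrite -mean_qprojE.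
rewrite -ge0_integral_sum//.
rewrite -[leRHS]adde0 -[X in (_ + X)%E](mule0 k%:R%:E) -[X in (_ * X)%E]F0.
rewrite -ge0_integralZl// -ge0_integralD//; last 2 first.
- by move=> w _; exact: sume_ge0.
- by move=> w _; exact: mule_ge0.
rewrite [leLHS]kE; apply: ge0_le_integral => //.
- by move=> w _; rewrite lee_fin.
- exact: emeasurable_funD.
move=> w _ /=; rewrite sumEFin -EFinM -EFinD lee_fin /chi indicE.
have [Fw|Fw] := eqVneq (F (S w)) 0.
  by rewrite Fw mem_set// mulr1 lerDr sumr_ge0// => i _; rewrite qproj_ge0.
by rewrite tr ?Ffree// lerDl mulr_ge0.
Qed.

(* The first r - 1 indices carry at most r - 1 <= k / 2 of the trace. *)
Lemma mean_qproj_ge r c x : 1 <= c -> (2 * r <= k)%N -> (0 < r)%N ->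
  (forall i j : 'I_n, (r <= j.+1)%N -> l j <= c * l i) ->
  k%:R / (2 * c ^+ 2 * n%:R) * sqn x <= mean_qproj x.
Proof.
move=> c1 rk r0 lc; have c0 : 0 < c by exact: lt_le_trans c1.
have VVT : V *m V^T = 1%:M by exact: mulmx1C.
have vi i : k%:R / (2 * c ^+ 2 * n%:R) <= mean_qproj (v i).
  have n0 : 0 < n%:R :> R by rewrite ltr0n (leq_ltn_trans _ (ltn_ord i)).
  rewrite ler_pdivrMr ?mulr_gt0 ?exprn_gt0//.
  have head : \sum_(j < n | ~~ (r <= j.+1)%N) mean_qproj (v j) <= k%:R / 2.
    (* Ordinals start at 0, so the head is [j.+1 < r]. The indicator of [j < r] may count one index
       more, and the resulting bound by [r] is still at most k / 2. *)
    apply: (@le_trans _ _ (\sum_(j < n) ((j < r)%N : nat)%:R)).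
      rewrite big_mkcond; apply: ler_sum => j _.
      rewrite -ltnNge; case: ifPn => [jr|_]; last exact: ler0n.
      by rewrite (ltnW jr) -(sqn_v j) mean_qproj_le.
    rewrite -natr_sum ler_pdivlMr// -natrM ler_nat mulnC.
    apply: leq_trans rk; rewrite leq_mul2l/= -(big_mkord xpredT (fun j => j < r : nat)%N).
    suff -> q : (\sum_(0 <= j < q) (j < r : nat))%N = minn q r by exact: geq_minr.
    elim: q => [|q IH]; first by rewrite big_nil min0n.
    by rewrite big_nat_recr//= IH; lia.
  have tail : \sum_(j < n | (r <= j.+1)%N) mean_qproj (v j) <=
      n%:R * (c ^+ 2 * mean_qproj (v i)).
    apply: (@le_trans _ _ (\sum_(j < n) c ^+ 2 * mean_qproj (v i))).
      rewrite big_mkcond; apply: ler_sum => j _; case: ifP => [jr|_].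
        by apply: mean_qproj_swap => //; exact: lc.
      by rewrite mulr_ge0 ?mean_qproj_ge0 ?sqr_ge0.
    by rewrite sumr_const card_ord mulr_natl.
  have := mean_qproj_trace.
  rewrite (bigID (fun j : 'I_n => r <= j.+1)%N)/= => tot.
  have -> : mean_qproj (v i) * (2 * c ^+ 2 * n%:R) =
      2 * (n%:R * (c ^+ 2 * mean_qproj (v i))) by ring.
  by move: tot head tail; lra.
have -> : x = V *m (V^T *m x) by rewrite mulmxA VVT mul1mx.
rewrite mean_qproj_basis.
have -> : sqn (V *m (V^T *m x)) = sqn (V^T *m x).
  by rewrite /sqn dot_mulmx (mulmxA V^T V) VV mul1mx.
rewrite [X in _ * X]sqnE mulr_sumr; apply: ler_sum => i _.
by rewrite mulrC ler_wpM2l ?sqr_ge0.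
Qed.

End MeanProjection.

(** * Contraction of the iterates *)

Section SingularVectors.
Context {R : realType} {m n : nat} (A : 'M[R]_(m, n)).
Hypothesis rA : \rank A = n.

Lemma size_singular_values : size (singular_values A) = n.
Proof.
have [_ _ /(congr1 (fun p : {poly R} => size p))] := singular_valuesP A.
rewrite size_char_poly -(big_map (fun x => x ^+ 2) xpredT (fun x => 'X - x%:P)).
by rewrite size_prod_XsubC size_map => -[].
Qed.

Lemma right_singular_vectors : exists V : 'M[R]_n, V^T *m V = 1%:M /\
  forall i, A^T *m A *m col i V = (sigma A i.+1 ^+ 2) *: col i V.
Proof.
have [_ _ cA] := singular_valuesP A.
have Asym : (A^T *m A)^T = A^T *m A by rewrite trmx_mul trmxK.
rewrite -(big_map (fun x => x ^+ 2) xpredT (fun x => 'X - x%:P)) in cA.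
have [V [VV AV]] := sym_spectral Asym cA.
exists V; split=> // i; rewrite [in LHS]colE mulmxA AV -colE.
apply/colP => a; rewrite !mxE (bigD1 i)//= big1 => [|j ji]; last first.
  by rewrite !mxE (negbTE ji) mulr0.
rewrite !mxE eqxx addr0 mulr1n mulrC; congr (_ * _).
by rewrite (nth_map 0) ?size_singular_values.
Qed.

Lemma sigma_gt0 (V : 'M[R]_n) : V^T *m V = 1%:M ->
  (forall i, A^T *m A *m col i V = (sigma A i.+1 ^+ 2) *: col i V) ->
  forall i : 'I_n, 0 < sigma A i.+1 ^+ 2.
Proof.
move=> VV AV i; rewrite lt_neqAle sqr_ge0 andbT eq_sym; apply/negP => /eqP s0.
have Av : A *m col i V = 0.
  apply/eqP; rewrite -sqn_eq0 /sqn dot_mulmx mulmxA AV s0 scale0r.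
  by rewrite /dot trmx0 mul0mx mxE.
have v0 : col i V = 0.
  have fA : row_full A by rewrite /row_full rA.
  by rewrite -[LHS]mul1mx -(mulVpmx fA) -mulmxA Av mulmx0.
move/matrixP/(_ i i): VV; rewrite !mxE eqxx big1 => [/eqP|j _].
  by rewrite eq_sym oner_eq0.
by move/colP/(_ j): v0; rewrite !mxE => ->; rewrite mulr0.
Qed.

Lemma sigma_min_le (i : 'I_n) : sigma_min A ^+ 2 <= sigma A i.+1 ^+ 2.
Proof.
have [so /allP p0 _] := singular_valuesP A.
have i0 : (i < size (singular_values A))%N by rewrite size_singular_values.
have n0 : (n.-1 < size (singular_values A))%N.
  by rewrite size_singular_values ltn_predL (leq_ltn_trans _ (ltn_ord i)).
rewrite lerXn2r ?nnegrE ?p0 ?mem_nth//.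
apply: (sorted_leq_nth _ _ _ so); rewrite ?inE//.
- by move=> x y z xy yz; exact: le_trans yz xy.
- exact: lexx.
- by have := ltn_ord i; lia.
Qed.

End SingularVectors.

Section Iterates.
Context {R : realType} {m n k : nat}.
Variables (A : 'M[R]_(m, n)) (b : 'cV[R]_m) (xs x0 : 'cV[R]_n).
Hypothesis Axs : A *m xs = b.

Lemma sketch_project_error (S : nat -> 'M[R]_(k, m)) t :
  sketch_project A b S x0 t.+1 - xs =
  (sketch_project A b S x0 t - xs)
    - rproj (S t *m A) *m (sketch_project A b S x0 t - xs).
Proof.
rewrite /= -Axs -mulmxBr /rproj -!mulmxA.
by rewrite addrAC.
Qed.

(** Only the sketches before time [t] are assumed measurable, and the space is arbitrary: over the
    sigma-algebra generated by the past, this says that the error is adapted. *)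
Lemma sketch_project_measurable d (T : measurableType d)
    (S : nat -> T -> 'M[R]_(k, m)) t :
  (forall u, (u < t)%N -> mx_measurable (S u)) ->
  mx_measurable (fun w => sketch_project A b (fun u => S u w) x0 t - xs).
Proof.
elim: t => [_ /=|t IH mS]; first exact: mx_measurable_cst.
have me := IH (fun u ut => mS u (ltnW ut)).
move=> i j; under eq_fun do rewrite sketch_project_error.
apply: mx_measurable_add => //; apply: mx_measurable_opp.
apply: mx_measurable_mul => //; apply: mx_measurable_rproj.
by apply: mx_measurable_mul; [exact: mS|exact: mx_measurable_cst].
Qed.

End Iterates.

Section Contraction.
Context {d : measure_display} {T : measurableType d} {R : realType}.
Variables (P : probability T R) (m n k : nat) (S : nat -> T -> 'M[R]_(k, m)).
Variables (A : 'M[R]_(m, n)) (b : 'cV[R]_m) (xs x0 : 'cV[R]_n) (q : R).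
Hypothesis iidS : iid_gaussian_matrices P S.
Hypothesis Axs : A *m xs = b.
Hypothesis q01 : 0 <= q <= 1.
Hypothesis meanq : forall t v, q * sqn v <= mean_qproj P (S t) A v.

Let F t := sigma_of_mx (S t).

Let mS t : mx_measurable (S t).
Proof. by have [/(_ t) gS _] := iidS; exact: (gaussian_mx_measurable gS). Qed.

Let gens t := \bigcup_(ij in [set: 'I_k * 'I_m])
  sigma_of_rv (fun w => S t w ij.1 ij.2).

Let mF t : F t `<=` measurable.
Proof.
apply: g_sigma_sub => B [ij _]; apply: sigma_of_rv_measurable; exact: mS.
Qed.

Let FI t : setI_closed (F t).
Proof.
move=> B C FB FC.
exact: (@measurableI _ (g_sigma_algebraType (gens t))).
Qed.

Let FT t : F t setT.
Proof. exact: (@measurableT _ (g_sigma_algebraType (gens t))). Qed.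

Let mS_cyl (J : set nat) t : J t ->
  @mx_measurable _ _ (g_sigma_algebraType (cylinders F J)) _ _ (S t).
Proof.
move=> Jt i j _ B mB; apply: sub_sigma_algebra.
apply: (sub_cylinders FT Jt); apply: sub_sigma_algebra.
by exists (i, j) => //; exists B.
Qed.

Let err t w := sketch_project A b (fun u => S u w) x0 t - xs.

Let merr t : mx_measurable (err t).
Proof. by apply: sketch_project_measurable => // u _; exact: mS. Qed.

(** The error at time [t] depends on the earlier sketches only, so it may be frozen while [S t] is
    averaged, and [meanq] applies to each frozen value. *)
Lemma sketch_step t :
  (q%:E * \int[P]_w (sqn (err t w))%:E <=
   \int[P]_w (qproj (S t w *m A) (err t w))%:E)%E.
Proof.
pose G1 := cylinders F [set u | (u < t)%N]; pose G2 := cylinders F [set t].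
have J12 : [set u | (u < t)%N] `&` [set t] = set0.
  by apply/seteqP; split => // u /= [ut uE]; rewrite uE ltnn in ut.
have qp0 B v : (0 <= (qproj B v : R)%:E)%E by rewrite lee_fin qproj_ge0.
have me1 : @mx_measurable _ _ (g_sigma_algebraType G1) _ _ (err t).
  apply: (@sketch_project_measurable _ _ _ _ _ _ _ _ Axs _
    (g_sigma_algebraType G1)) => u ut; exact: mS_cyl.
rewrite (@decoupling _ _ _ P G1 G2
  (fun w1 w2 => (qproj (S t w2 *m A) (err t w1))%:E)) //; first last.
- apply/measurable_EFinP; apply: (@measurable_qproj _ _
      (g_sigma_algebraType G1 * g_sigma_algebraType G2)%type _ _
      (fun w => S t w.2 *m A) (fun w => err t w.1)).
    apply: mx_measurable_mul; last exact: mx_measurable_cst.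
    move=> i j; apply: (measurableT_comp
      (f := fun w : g_sigma_algebraType G2 => S t w i j)) => //.
    exact: mS_cyl.
  move=> i j; apply: (measurableT_comp
    (f := fun w : g_sigma_algebraType G1 => err t w i j)) => //.
- exact: cylinders_indep iidS.2 _ _ J12.
- exact: cylinders_measurable.
- exact: cylinders_measurable.
have msqn : measurable_fun setT (fun w => (sqn (err t w))%:E).
  by apply/measurable_EFinP; exact: measurable_dot.
have [q0 _] := andP q01.
rewrite -ge0_integralZl//; last first.
  by move=> w _; rewrite lee_fin sqn_ge0.
apply: ge0_le_integral => //.
- by move=> w _; rewrite mule_ge0// lee_fin ?sqn_ge0.
- exact: measurable_funeM.
- apply: (measurable_fun_fubini_tonelli_F (m2 := P)
    (fun z : T * T => (qproj (S t z.2 *m A) (err t z.1))%:E)) => [|z//].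
  apply/measurable_EFinP; apply: measurable_qproj; last first.
    by move=> i j; exact: (measurableT_comp (merr t i j)).
  apply: mx_measurable_mul; last exact: mx_measurable_cst.
  by move=> i j; exact: (measurableT_comp (mS t i j)).
- move=> w _; rewrite (mean_qprojE A (iidS.1 t)) -EFinM lee_fin.
  exact: meanq.
Qed.

Lemma sketch_contraction t :
  (\int[P]_w (sqn (err t w))%:E <= ((1 - q) ^+ t * sqn (x0 - xs))%:E)%E.
Proof.
elim: t => [|t IH].
  rewrite expr0 mul1r /err /= -[leRHS]mule1 -(@probability_setT _ _ _ P).
  by rewrite -integral_cst.
have msqn u : measurable_fun setT (fun w => (sqn (err u w))%:E).
  by apply/measurable_EFinP; exact: measurable_dot.
have mq : measurable_fun setT (fun w => (qproj (S t w *m A) (err t w))%:E).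
  apply/measurable_EFinP; apply: measurable_qproj => //.
  by apply: mx_measurable_mul => //; exact: mx_measurable_cst.
(* Pythagoras for the projection, kept as a sum of nonnegative integrals; finiteness is established
   next, and only then is the identity read in the reals. *)
have split_t : (\int[P]_w (sqn (err t.+1 w))%:E +
    \int[P]_w (qproj (S t w *m A) (err t w))%:E =
    \int[P]_w (sqn (err t w))%:E)%E.
  rewrite -ge0_integralD//.
  - apply: eq_integral => w _; rewrite -EFinD /err sketch_project_error//.
    by rewrite sqn_subproj subrK.
  - by move=> w _; rewrite lee_fin sqn_ge0.
  - by move=> w _; rewrite lee_fin qproj_ge0.
have i0 u : (0 <= \int[P]_w (sqn (err u w))%:E)%E.
  by apply: integral_ge0 => w _; rewrite lee_fin sqn_ge0.
have p0 : (0 <= \int[P]_w (qproj (S t w *m A) (err t w))%:E)%E.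
  by apply: integral_ge0 => w _; rewrite lee_fin qproj_ge0.
have [a aE] : exists a, (\int[P]_w (sqn (err t w))%:E = a%:E)%E.
  exists (fine (\int[P]_w (sqn (err t w))%:E)); rewrite fineK//.
  by rewrite ge0_fin_numE// (le_lt_trans IH)// ltry.
have [a' a'E] : exists a', (\int[P]_w (sqn (err t.+1 w))%:E = a'%:E)%E.
  exists (fine (\int[P]_w (sqn (err t.+1 w))%:E)); rewrite fineK//.
  by rewrite ge0_fin_numE// (@le_lt_trans _ _ a%:E)%E ?ltry// -aE -split_t leeDl.
have [p pE] : exists p, (\int[P]_w (qproj (S t w *m A) (err t w))%:E = p%:E)%E.
  exists (fine (\int[P]_w (qproj (S t w *m A) (err t w))%:E)); rewrite fineK//.
  by rewrite ge0_fin_numE// (@le_lt_trans _ _ a%:E)%E ?ltry// -aE -split_t leeDr.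
move: split_t (sketch_step t) IH; rewrite aE a'E pE.
rewrite -EFinM -EFinD => -[ap]; rewrite !lee_fin => step IH.
have [q0 q1] := andP q01.
have IH' := ler_wpM2l (_ : 0 <= 1 - q) IH.
rewrite exprS -mulrA; apply: le_trans (IH' _); last by rewrite subr_ge0.
by rewrite mulrBl mul1r; lra.
Qed.

End Contraction.

Theorem corollary3p5 (R : realType) :
  exists C1 : R, 0 < C1 /\
  forall c : R, 1 <= c ->
  exists C : R, 0 < C /\
  forall (m n r k : nat) (A : 'M[R]_(m, n)) (b : 'cV[R]_m) (xstar : 'cV[R]_n),
    (n <= m)%N ->
    \rank A = n ->
    (1 <= r <= n)%N ->
    (forall i : nat, (r <= i <= n)%N ->
       sigma A i ^+ 2 <= c * sigma_min A ^+ 2) ->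
    unique (fun x => A *m x = b) xstar ->
    (k <= n)%N -> (2 * r <= k)%N -> C1 <= k%:R ->
  forall (d : measure_display) (T : measurableType d) (P : probability T R)
    (S : nat -> T -> 'M[R]_(k, m)),
    iid_gaussian_matrices P S ->
  forall (x0 : 'cV[R]_n) (t : nat),
    ('E_P[fun w =>
        (norm2 (sketch_project A b (fun u => S u w) x0 t - xstar) ^+ 2)%R]
      <= ((1 - k%:R / (C * n%:R)) ^+ t * norm2 (x0 - xstar) ^+ 2)%:E)%E.
Proof.
exists 1; split=> // c c1; have c0 : 0 < c by exact: lt_le_trans c1.
exists (2 * c ^+ 2); split; first by rewrite mulr_gt0// exprn_gt0.
move=> m n r k A b xs nm rA /andP[r1 rn] tail [Axs _] kn rk _ d T P S iidS x0 t.
have n0 : 0 < n%:R :> R by rewrite ltr0n (leq_trans r1).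
have [V [VV AV]] := right_singular_vectors A.
have l0 := sigma_gt0 rA VV AV.
have lc (i j : 'I_n) : (r <= j.+1)%N ->
    sigma A j.+1 ^+ 2 <= c * sigma A i.+1 ^+ 2.
  move=> rj; apply: (le_trans (tail _ _)); first by rewrite rj ltn_ord.
  by rewrite ler_wpM2l ?(ltW c0)// sigma_min_le.
have meanq u v : k%:R / (2 * c ^+ 2 * n%:R) * sqn v <= mean_qproj P (S u) A v.
  exact: (mean_qproj_ge (iidS.1 u) VV AV l0 rA kn v c1 rk r1 lc).
have q01 : 0 <= k%:R / (2 * c ^+ 2 * n%:R) <= 1.
  have cn0 : 0 < 2 * c ^+ 2 * n%:R by rewrite !mulr_gt0// exprn_gt0.
  rewrite divr_ge0 ?ler0n ?(ltW cn0)//= ler_pdivrMr// mul1r.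
  have kn' : k%:R <= n%:R :> R by rewrite ler_nat.
  rewrite (le_trans kn')// ler_peMl// ?ltW//.
  have : 1 <= c ^+ 2 by rewrite expr2 mulr_ege1.
  by lra.
rewrite unlock norm2_sqr; under eq_integral do rewrite norm2_sqr.
exact: (sketch_contraction x0 iidS Axs q01 meanq).
Qed.
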